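(* Let $\{A_k\}_{k\ge 0}$ be i.i.d. complex valued random variables with the standard complex normal distribution $N_{\mathbb{C}}(0,1)$, and let $P_n(z)=\sum_{k=0}^n A_k z^k$. Then the expected Bernstein-Markov factors in the sup norm on the unit circle satisfy $$\frac{1}{2}\le\liminf_{n\to\infty}\frac{1}{n}\,\mathbb{E}\left[\frac{\|P_n'\|_\infty}{\|P_n\|_\infty}\right]\le\limsup_{n\to\infty}\frac{1}{n}\,\mathbb{E}\left[\frac{\|P_n'\|_\infty}{\|P_n\|_\infty}\right]\le\sqrt{\frac{2}{3}}.$$
   Context: For a polynomial $P$, $\|P\|_\infty=\sup_{|z|=1}|P(z)|$, and $P'$ is the derivative of $P$ in $z$. The standard complex normal distribution $N_{\mathbb{C}}(0,1)$ is the distribution on $\mathbb{C}$ with density $\frac{1}{\pi}\exp(-|z|^2)$ with respect to Lebesgue measure. Convention: the ratio $\|P'\|_\infty/\|P\|_\infty$ is set equal to $0$ when $P\equiv 0$. *)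

(* Defs.v *)
From HB Require Import structures.
From mathcomp Require Import all_boot all_order all_algebra.
From mathcomp Require Import finmap.
From mathcomp Require Import complex.
From mathcomp Require Import all_classical all_reals all_analysis.
Import Order.TTheory GRing.Theory Num.Theory.

Set Implicit Arguments.
Unset Strict Implicit.
Unset Printing Implicit Defensive.

Local Open Scope classical_set_scope.
Local Open Scope ring_scope.
Local Open Scope complex_scope.

HB.instance Definition _ (R : realType) := isPointed.Build R[i] 0.

Definition complex_pair (R : realType) (z : R[i]) : R * R :=
  (complex.Re z, complex.Im z).

(* R[i] carries the Borel sigma-algebra of the plane, transported along the
   bijection z |-> (Re z, Im z). *)
HB.instance Definition _ (R : realType) :=
  Measurable.copy R[i] (g_sigma_algebra_preimageType (@complex_pair R)).

(* The norm `|z| of R[i] is itself R[i]-valued; cmod z is the same modulus as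
   an element of R. *)
Definition cmod (R : realType) (z : R[i]) : R := complex.Re `|z|.

Definition complex_normal_pdf (R : realType) (z : R[i]) : R :=
  pi^-1 * expR (- cmod z ^+ 2).

Definition complex_normal_prob (R : realType) (B : set R[i]) : \bar R :=
  (\int[(@lebesgue_measure R \x @lebesgue_measure R)]_(p in
     [set p : R * R | B (p.1 +i* p.2)])
     (complex_normal_pdf (p.1 +i* p.2))%:E)%E.

Definition mutually_independent d d' (T : measurableType d)
    (T' : measurableType d') (R : realType) (P : probability T R)
    (I : choiceType) (X : I -> {RV P >-> T'}) : Prop :=
  forall (J : {fset I}) (B : I -> set T'), (forall k, measurable (B k)) ->
  (P (\bigcap_(k in [set` J]) (X k @^-1` B k)) =
   \prod_(k <- J) P (X k @^-1` B k))%E.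

Definition circle_sup_norm (R : realType) (p : {poly R[i]}) : R :=
  sup [set cmod p.[z] | z in [set z : R[i] | cmod z = 1]].

(* Division by 0 yields 0, so the factor of the zero polynomial is 0. *)
Definition bernstein_markov_factor (R : realType) (p : {poly R[i]}) : R :=
  circle_sup_norm p^`() / circle_sup_norm p.

Definition random_poly d (T : measurableType d) (R : realType)
    (P : probability T R) (A : nat -> {RV P >-> R[i]}) (n : nat) (w : T) :
    {poly R[i]} :=
  \poly_(k < n.+1) A k w.

(* Main.v *)
(* Lower bound. If Q is P with its coefficients reversed, then |zP'(z) - nP(z)|
   = |Q'(1/z)| on the circle, so n ||P|| <= ||P'|| + ||Q'|| while ||Q|| = ||P||;
   and Q has the law of P.

   Upper bound. Parseval over roots of unity, applied to P times a geometric sum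
   that peaks at a given point of the circle, shows that ||P||^2 is at most
   (n + m) / m times the maximum of |P|^2 over the (n + m)-th roots of unity, and
   that ||P'|| <= 4 n ||P||. A Chernoff bound at these points gives ||P'||^2 <=
   c S log n with high probability, where S = 1^2 + ... + n^2 and c is slightly
   above 1. The values of P at the (n + 1)-th roots of unity are uncorrelated, and
   a truncated second moment argument for the sum of their exponentials gives
   ||P||^2 >= c' n log n with high probability, c' slightly below 1. Since
   c / (3 c') < 2 / 3, the ratio is at most n sqrt(2/3) outside an event of
   vanishing probability, on which it is at most 4 n. The only probabilistic input
   is the exponential moment of a linear combination of the coefficients. *)

Require Import Defs.
From HB Require Import structures.
From mathcomp Require Import all_boot all_order all_algebra.
From mathcomp Require Import finmap.
From mathcomp Require Import complex.
From mathcomp Require Import all_classical all_reals all_analysis.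
From mathcomp Require Import measurable_realfun.
From mathcomp Require Import cyclic separable cyclotomic.
From mathcomp Require Import ring lra.
Import Order.TTheory GRing.Theory Num.Theory.
Import numFieldNormedType.Exports.

Set Implicit Arguments.
Unset Strict Implicit.
Unset Printing Implicit Defensive.

Local Open Scope classical_set_scope.
Local Open Scope ring_scope.

(** * Roots of unity: sampling and a Bernstein inequality *)

(** [X^N - 1] is separable in characteristic zero, so it has N distinct roots, and N distinct N-th
    roots of unity include a primitive one. *)
Lemma prim_root_exists (C : numClosedFieldType) (N : nat) :
  (0 < N)%N -> exists w : C, N.-primitive_root w.
Proof.
move=> N0; pose p : {poly C} := 'X^N - 1.
have [r Dp] := closed_field_poly_normal p.
have sz : size p = N.+1 by rewrite size_XnsubC.
move: Dp; rewrite (monicP _) ?monicXnsubC// scale1r => Dp.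
have rn1 : all N.-unity_root r by apply/allP => z; rewrite -root_prod_XsubC -Dp.
have sz_r : (N < (size r).+1)%N by rewrite -(size_prod_XsubC r id) -Dp sz.
have [|w] := hasP (has_prim_root N0 rn1 _ sz_r); last by exists w.
rewrite -separable_prod_XsubC -Dp separable_Xn_sub_1//.
by rewrite pnatr_eq0 -lt0n.
Qed.

Lemma norm_prim_root (C : numClosedFieldType) (N : nat) (w : C) :
  N.-primitive_root w -> `|w| = 1.
Proof.
move=> wP; apply: (pexpIrn (prim_order_gt0 wP)) => //; rewrite ?nnegrE//.
by rewrite expr1n -normrX (prim_expr_order wP) normr1.
Qed.

Lemma prim_root_sum (C : numClosedFieldType) (N : nat) (w : C) (i j : nat) :
  N.-primitive_root w -> (i < N)%N -> (j < N)%N ->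
  \sum_(l < N) w ^+ (l * i) * (w ^+ (l * j))^* = (i == j)%:R * N%:R.
Proof.
move=> wP iN jN.
have w1 : `|w| = 1 by exact: norm_prim_root wP.
have w0 : w != 0 by rewrite -normr_eq0 w1 oner_eq0.
have wc : w^* = w^-1 by rewrite invC_norm w1 expr1n invr1 mul1r.
pose q := w ^+ i * w^-1 ^+ j.
have -> : \sum_(l < N) w ^+ (l * i) * (w ^+ (l * j))^* = \sum_(l < N) q ^+ l.
  apply: eq_bigr => l _; rewrite rmorphXn/= wc exprMn -!exprM.
  by rewrite [(i * l)%N]mulnC [(j * l)%N]mulnC.
have [ij|ij] := eqVneq i j.
  rewrite /q ij (_ : _ * _ = 1); last by rewrite -exprMn divff// expr1n.
  under eq_bigr do rewrite expr1n.
  by rewrite sumr_const card_ord mul1r.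
(* Off the diagonal the sum is geometric with ratio [q != 1], and it vanishes because
   [q ^+ N = 1]. *)
rewrite mul0r; apply: (mulfI (_ : q - 1 != 0)).
  rewrite subr_eq0; apply: contra_neq ij => q1.
  have /eqP : w ^+ i = w ^+ j.
    by rewrite -[LHS]mulr1 -(expr1n _ j) -(mulVf w0) exprMn mulrA -/q q1 mul1r.
  by rewrite (eq_prim_root_expr wP) !modn_small// => /eqP.
rewrite mulr0 -subrX1 /q exprMn -!exprM ![(_ * N)%N]mulnC !exprM.
by rewrite exprVn !(prim_expr_order wP) invr1 !expr1n mulr1 subrr.
Qed.

Lemma parseval (C : numClosedFieldType) (N : nat) (w : C) (h : {poly C}) :
  N.-primitive_root w -> (size h <= N)%N ->
  \sum_(l < N) `|h.[w ^+ l]| ^+ 2 = N%:R * \sum_(k < N) `|h`_k| ^+ 2.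
Proof.
move=> wP hN.
transitivity (\sum_(l < N) \sum_(i < N) \sum_(j < N)
    h`_i * (h`_j)^* * (w ^+ (l * i) * (w ^+ (l * j))^*)).
  apply: eq_bigr => l _; rewrite normCK (horner_coef_wide _ hN) rmorph_sum/=.
  rewrite mulr_suml; apply: eq_bigr => i _; rewrite mulr_sumr.
  by apply: eq_bigr => j _; rewrite rmorphM/= -!exprM; ring.
rewrite exchange_big/= mulr_sumr; apply: eq_bigr => i _.
rewrite exchange_big/= (bigD1 i)//= [X in _ + X]big1 ?addr0 => [|j ji].
  by rewrite -mulr_sumr prim_root_sum// eqxx mul1r normCK mulrC.
by rewrite -mulr_sumr prim_root_sum// eq_sym -val_eqE in ji *; rewrite (negbTE ji) mul0r mulr0.
Qed.

(** Rotating [h] by [z] preserves the moduli of its coefficients and moves [z] to [w ^+ 0], so the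
    left side becomes a single term of a Parseval sum. *)
Lemma parseval_horner_le (C : numClosedFieldType) (N : nat) (h : {poly C}) (z : C) :
  (size h <= N)%N -> `|z| = 1 ->
  `|h.[z]| ^+ 2 <= N%:R * \sum_(k < N) `|h`_k| ^+ 2.
Proof.
case: N => [|N] hN z1.
  by move: hN; rewrite leqn0 size_poly_eq0 => /eqP ->; rewrite horner0 normr0 expr0n mul0r.
have [w wP] := prim_root_exists C (ltn0Sn N).
pose g : {poly C} := \poly_(k < N.+1) (h`_k * z ^+ k).
have gE x : g.[x] = h.[x * z].
  rewrite horner_poly (horner_coef_wide _ hN).
  by apply: eq_bigr => k _; rewrite exprMn; ring.
have := parseval wP (size_poly _ _ : (size g <= N.+1)%N).
rewrite (_ : \sum_(k < N.+1) `|g`_k| ^+ 2 = \sum_(k < N.+1) `|h`_k| ^+ 2); last first.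
  by apply: eq_bigr => k _; rewrite coef_poly ltn_ord normrM normrX z1 expr1n mulr1.
move=> <-; rewrite big_ord_recl/= expr0 gE mul1r lerDl.
by apply: sumr_ge0 => i _; rewrite exprn_ge0.
Qed.

(* The geometric sum \sum_(i < m) (x / z) ^+ i, for z on the unit circle. *)
Definition dirichlet_poly (C : numClosedFieldType) (m : nat) (z : C) : {poly C} :=
  \poly_(i < m) (z^* ^+ i).

Lemma dirichlet_sum (C : numClosedFieldType) (m N : nat) (z w : C) :
  N.-primitive_root w -> (m <= N)%N -> `|z| = 1 ->
  \sum_(l < N) `|(dirichlet_poly m z).[w ^+ l]| ^+ 2 = N%:R * m%:R.
Proof.
move=> wP mN z1; rewrite (parseval wP) ?(leq_trans (size_poly _ _))//; congr (_ * _).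
rewrite -[m in RHS]card_ord -sumr_const (big_ord_widen N (fun=> 1) mN) [RHS]big_mkcond/=.
apply: eq_bigr => k _; rewrite coef_poly; case: ifP => _; last by rewrite normr0 expr0n.
by rewrite normrX norm_conjC z1 !expr1n.
Qed.

Lemma dirichlet_horner (C : numClosedFieldType) (m : nat) (z : C) :
  `|z| = 1 -> (dirichlet_poly m z).[z] = m%:R.
Proof.
move=> z1; rewrite horner_poly; under eq_bigr do rewrite -exprMn mulrC -normCK z1 !expr1n.
by rewrite sumr_const card_ord.
Qed.

(** Parseval turns the left side into a mean over the sampling points, where |Q| is at most B; what
    remains is the known energy of the geometric sum. *)
Lemma sampled_mul_dirichlet (C : numClosedFieldType) (m N : nat) (z w B : C) (Q : {poly C}) :
  N.-primitive_root w -> (m <= N)%N -> `|z| = 1 ->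
  (size (Q * dirichlet_poly m z)%R <= N)%N ->
  (forall l, (l < N)%N -> `|Q.[w ^+ l]| <= B) ->
  \sum_(k < N) `|(Q * dirichlet_poly m z)`_k| ^+ 2 <= B ^+ 2 * m%:R.
Proof.
move=> wP mN z1 sQ QB.
have N0 : (0 < N%:R :> C) by rewrite ltr0n (prim_order_gt0 wP).
have B0 : 0 <= B by apply: le_trans (QB 0%N _) => //; exact: prim_order_gt0 wP.
rewrite -(ler_pM2l N0) -(parseval wP sQ) mulrCA -(dirichlet_sum wP mN z1) mulr_sumr.
apply: ler_sum => l _; rewrite hornerM normrM exprMn ler_wpM2r ?exprn_ge0//.
by rewrite lerXn2r ?nnegrE//; exact: QB.
Qed.

Lemma size_mul_dirichlet (C : numClosedFieldType) (m n : nat) (z : C) (Q : {poly C}) :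
  (size Q <= n.+1)%N -> (size (Q * dirichlet_poly m z)%R <= n + m)%N.
Proof.
move=> Qn; apply: leq_trans (size_polyMleq _ _) _.
by rewrite -subn1 leq_subLR add1n -addSn leq_add// size_poly.
Qed.

(** The geometric sum equals m at [z], hence m^2 |Q(z)|^2 is at most n + m times the energy of the
    coefficients of the product, which is at most B^2 m; one factor m cancels. *)
Lemma sampling (C : numClosedFieldType) (n m : nat) (w z B : C) (Q : {poly C}) :
  (n + m).-primitive_root w -> (size Q <= n.+1)%N -> `|z| = 1 ->
  (forall l, (l < n + m)%N -> `|Q.[w ^+ l]| <= B) ->
  m%:R * `|Q.[z]| ^+ 2 <= (n + m)%:R * B ^+ 2.
Proof.
move=> wP Qn z1 QB.
have [->|m0] := posnP m.
  by rewrite mul0r mulr_ge0// exprn_ge0// (le_trans _ (QB 0%N (prim_order_gt0 wP))).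
have sh := size_mul_dirichlet m z Qn.
have := parseval_horner_le sh z1.
rewrite hornerM dirichlet_horner// normrM normr_nat exprMn => h1.
have := sampled_mul_dirichlet wP (leq_addl _ _) z1 sh QB.
rewrite -(ler_pM2l (_ : 0 < (n + m)%:R :> C)) ?ltr0n ?(prim_order_gt0 wP)// => /(le_trans h1) h2.
have m1 : 0 < m%:R :> C by rewrite ltr0n.
rewrite -(ler_pM2l m1).
have -> : m%:R * (m%:R * `|Q.[z]| ^+ 2) = `|Q.[z]| ^+ 2 * m%:R ^+ 2 by ring.
by rewrite [leRHS]mulrC -[leRHS]mulrA.
Qed.

Lemma size_deriv_leq (R : nzRingType) (n : nat) (p : {poly R}) :
  (size p <= n.+1)%N -> (size p^`() <= n)%N.
Proof. by move=> pn; rewrite (leq_trans (size_poly _ _))// -subn1 leq_subLR add1n. Qed.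

(** With [g] the geometric sum at [z] and [h = p * g], one has n p'(z) = h'(z) - p(z) g'(z). The
    coefficients of [h] are controlled in mean square, differentiation costs a factor of at most 2n
    there, and |g'(z)| is at most n^2. The constant 4 is not sharp, but any bound linear in n will
    do on a rare event. *)
Lemma bernstein_weak (C : numClosedFieldType) (n : nat) (z M : C) (p : {poly C}) :
  (0 < n)%N -> (size p <= n.+1)%N -> `|z| = 1 ->
  (forall x, `|x| = 1 -> `|p.[x]| <= M) ->
  `|p^`().[z]| <= 4 * n%:R * M.
Proof.
move=> n0 pn z1 pM.
have M0 : 0 <= M by apply: le_trans (pM 1 _); rewrite ?normr1.
have [w wP] : exists w : C, (n + n).-primitive_root w.
  by apply: prim_root_exists; rewrite addn_gt0 n0.
set g := dirichlet_poly n z; pose h := p * g.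
have sh : (size h <= n + n)%N := size_mul_dirichlet n z pn.
have n1 : 0 < n%:R :> C by rewrite ltr0n.
have hb : \sum_(k < n + n) `|h`_k| ^+ 2 <= M ^+ 2 * n%:R.
  apply: (sampled_mul_dirichlet wP (leq_addl _ _) z1 sh) => l _.
  by apply: pM; rewrite normrX (norm_prim_root wP) expr1n.
(* Parseval gives 8 n^4 M^2 for the square; rounding 8 up to 9 avoids a square root. *)
have dh : `|h^`().[z]| <= 3 * n%:R ^+ 2 * M.
  rewrite -(@ler_pXn2r _ 2)// ?nnegrE ?mulr_ge0 ?exprn_ge0//.
  apply: le_trans (parseval_horner_le (size_deriv_leq (leqW sh)) z1) _.
  have : \sum_(k < n + n) `|h^`()`_k| ^+ 2 <= (n + n)%:R ^+ 2 * (M ^+ 2 * n%:R).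
    apply: le_trans (ler_wpM2l _ hb); rewrite ?exprn_ge0// mulr_sumr.
    apply: (@le_trans _ _ (\sum_(k < n + n) (n + n)%:R ^+ 2 * `|h`_k.+1| ^+ 2)).
      apply: ler_sum => k _; rewrite coef_deriv normrMn -[_ *+ k.+1]mulr_natl exprMn.
      by rewrite ler_wpM2r ?exprn_ge0// lerXn2r ?nnegrE// ler_nat.
    rewrite -!mulr_sumr ler_wpM2l ?exprn_ge0//.
    (* The coefficient of index n + n is zero by the size bound, so the range may be extended before
       the term of index 0 is dropped. *)
    have <- : \sum_(k < (n + n).+1) `|h`_k| ^+ 2 = \sum_(k < n + n) `|h`_k| ^+ 2.
      by rewrite big_ord_recr/= [h`_(n + n)]nth_default// normr0 expr0n addr0.
    by rewrite big_ord_recl lerDr exprn_ge0.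
  move=> hd; apply: le_trans (ler_wpM2l (ler0n _ _) hd) _.
  rewrite natrD -subr_ge0 (_ : _ - _ = n%:R ^+ 4 * M ^+ 2); last by ring.
  by rewrite mulr_ge0 ?exprn_ge0.
have gz : `|g^`().[z]| <= n%:R ^+ 2.
  have sg : (size g^`() <= n)%N by exact: size_deriv_leq (leqW (size_poly _ _)).
  rewrite (horner_coef_wide _ sg); apply: le_trans (ler_norm_sum _ _ _) _.
  have -> : n%:R ^+ 2 = \sum_(k < n) n%:R :> C.
    by rewrite sumr_const card_ord expr2 -natrM mulrnA.
  apply: ler_sum => k _; rewrite normrM normrX z1 expr1n mulr1 coef_deriv coef_poly.
  rewrite normrMn -[_ *+ k.+1]mulr_natr; case: ifP => _; last by rewrite normr0 mul0r.
  by rewrite normrX norm_conjC z1 expr1n mul1r ler_nat.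
have : n%:R * p^`().[z] = h^`().[z] - p.[z] * g^`().[z].
  by rewrite /h derivM hornerD !hornerM dirichlet_horner//; ring.
move=> /(congr1 Num.norm); rewrite normrM normr_nat => e.
have : n%:R * `|p^`().[z]| <= 3 * n%:R ^+ 2 * M + M * n%:R ^+ 2.
  rewrite e; apply: le_trans (ler_normB _ _) _; rewrite lerD// normrM.
  by apply: ler_pM => //; exact: pM.
by rewrite (_ : _ + _ = n%:R * (4 * n%:R * M)) ?ler_pM2l//; ring.
Qed.

(** * Reversal of the coefficients *)

Definition rev_poly (C : nzRingType) (n : nat) (p : {poly C}) : {poly C} :=
  \poly_(k < n.+1) p`_(n - k).

Lemma rev_poly_horner (C : fieldType) (n : nat) (p : {poly C}) (x : C) :
  (size p <= n.+1)%N -> x != 0 -> (rev_poly n p).[x] = x ^+ n * p.[x^-1].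
Proof.
move=> pn x0; rewrite horner_poly (horner_coef_wide _ pn) mulr_sumr.
rewrite (reindex_inj rev_ord_inj)/=; apply: eq_bigr => k _.
rewrite subSS subKn ?(leq_ord k)// mulrCA; congr (_ * _).
by rewrite exprVn -expfB_cond ?(negbTE x0)// leq_ord.
Qed.

Lemma mulX_deriv_horner (R : comNzRingType) (N : nat) (p : {poly R}) (x : R) :
  (size p <= N)%N -> x * p^`().[x] = \sum_(k < N) p`_k *+ k * x ^+ k.
Proof.
case: N => [|N] pN.
  by move: pN; rewrite leqn0 size_poly_eq0 => /eqP ->; rewrite linear0 horner0 mulr0 big_ord0.
rewrite (horner_coef_wide _ (size_deriv_leq pN)) big_ord_recl mulr0n mul0r add0r.
by rewrite mulr_sumr; apply: eq_bigr => k _; rewrite coef_deriv exprS mulrCA.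
Qed.

(** Both sides are the sum of (n - k) p_k x^k: reversal sends the weight k of differentiation to n -
    k. *)
Lemma deriv_rev_poly_horner (F : fieldType) (n : nat) (p : {poly F}) (x : F) :
  (size p <= n.+1)%N -> x != 0 ->
  x ^+ n * (x^-1 * (rev_poly n p)^`().[x^-1]) = n%:R * p.[x] - x * p^`().[x].
Proof.
move=> pn x0; rewrite !(mulX_deriv_horner _ (N := n.+1)) ?size_poly//.
rewrite (horner_coef_wide _ pn) !mulr_sumr -sumrB (reindex_inj rev_ord_inj)/=.
apply: eq_bigr => k _; have kn : (k <= n)%N := leq_ord k.
rewrite coef_poly subSS ltnS leq_subr subKn// mulrnBr//.
have e : x ^+ n * x^-1 ^+ (n - k) = x ^+ k.
  by rewrite -{1}(subnKC kn) exprD exprVn -mulrA divff ?mulr1// expf_neq0.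
by rewrite mulrCA e mulrBl -[p`_k *+ n]mulr_natl -mulrA.
Qed.

Local Open Scope complex_scope.

(** * The sup norm on the circle *)

Section ComplexModulus.
Variable R : realType.
Implicit Types (x z : R[i]) (p : {poly R[i]}).

Lemma cmodC z : (cmod z)%:C = `|z|.
Proof. by rewrite /cmod RRe_real// ger0_real. Qed.

Lemma cmod_ge0 z : 0 <= cmod z.
Proof. by rewrite -ler0c cmodC. Qed.

Lemma cmodM x z : cmod (x * z) = cmod x * cmod z.
Proof. by apply: complexI; rewrite rmorphM/= !cmodC normrM. Qed.

Lemma cmodX z k : cmod (z ^+ k) = cmod z ^+ k.
Proof. by apply: complexI; rewrite rmorphXn/= !cmodC normrX. Qed.

Lemma cmod_nat k : cmod (k%:R : R[i]) = k%:R.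
Proof. by apply: complexI; rewrite cmodC normr_nat rmorph_nat. Qed.

Lemma cmod_real (r : R) : 0 <= r -> cmod r%:C = r.
Proof. by move=> r0; apply: complexI; rewrite cmodC ger0_norm// ler0c. Qed.

Lemma cmodV z : cmod z^-1 = (cmod z)^-1.
Proof. by apply: complexI; rewrite fmorphV/= !cmodC normfV. Qed.

Lemma cmodD x z : cmod (x + z) <= cmod x + cmod z.
Proof. by rewrite -lecR rmorphD/= !cmodC ler_normD. Qed.

Lemma cmod_sum (I : Type) (r : seq I) (P : pred I) (F : I -> R[i]) :
  cmod (\sum_(i <- r | P i) F i) <= \sum_(i <- r | P i) cmod (F i).
Proof.
rewrite -lecR cmodC rmorph_sum; apply: le_trans (ler_norm_sum _ _ _) _.
by apply: ler_sum => i _; rewrite -cmodC.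
Qed.

Lemma cmod_eq1 z : cmod z = 1 <-> `|z| = 1.
Proof. by rewrite -cmodC; split => [->//|[]]. Qed.

Lemma cmod_sqr z : cmod z ^+ 2 = complex.Re z ^+ 2 + complex.Im z ^+ 2.
Proof. by apply: complexI; rewrite add_Re2_Im2 rmorphXn/= cmodC. Qed.

Lemma Re_le_cmod z : complex.Re z <= cmod z.
Proof. by rewrite -lecR cmodC (le_trans _ (normc_ge_Re z))// lecR ler_norm. Qed.

Lemma cmod_prim_root N z : N.-primitive_root z -> cmod z = 1.
Proof. by move=> /norm_prim_root /cmod_eq1. Qed.

(** A fixed choice keeps the sampling points independent of the random outcome; the default 1 occurs
    only for N = 0. *)
Definition chosen_prim_root N : R[i] := xget 1 [set w : R[i] | N.-primitive_root w].

Lemma chosen_prim_rootP N : (0 < N)%N -> N.-primitive_root (chosen_prim_root N).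
Proof.
move=> N0; rewrite /chosen_prim_root; case: xgetP => [w _//|no].
by have [w wP] := prim_root_exists R[i] N0; case: (no w).
Qed.

(** Boundedness makes the [sup] in [circle_sup_norm] a genuine supremum and not a default value. *)
Lemma has_ubound_circle p :
  has_ubound [set cmod p.[z] | z in [set z : R[i] | cmod z = 1]].
Proof.
exists (\sum_(k < size p) cmod p`_k) => _ [z /= z1 <-].
rewrite horner_coef; apply: le_trans (cmod_sum _ _ _) _.
by apply: ler_sum => k _; rewrite cmodM cmodX z1 expr1n mulr1.
Qed.

Lemma circle_sup_norm_ge p z : cmod z = 1 -> cmod p.[z] <= circle_sup_norm p.
Proof. by move=> z1; apply: ub_le_sup (has_ubound_circle p) _ _; exists z. Qed.

Lemma circle_sup_norm_le p B :
  (forall z, cmod z = 1 -> cmod p.[z] <= B) -> circle_sup_norm p <= B.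
Proof.
move=> pB; apply: ge_sup => [|_ [z z1 <-]]; last exact: pB.
by exists (cmod p.[1]); exists 1 => //=; rewrite -[1]/(1%:R) cmod_nat.
Qed.

Lemma cmod1 : cmod (1 : R[i]) = 1.
Proof. by rewrite -[1]/(1%:R) cmod_nat. Qed.

Lemma circle_sup_norm_ge0 p : 0 <= circle_sup_norm p.
Proof. exact: le_trans (cmod_ge0 _) (circle_sup_norm_ge p cmod1). Qed.

Lemma cmod_sampling n m (w z : R[i]) (B : R) p :
  (n + m).-primitive_root w -> (size p <= n.+1)%N -> cmod z = 1 ->
  (forall l, (l < n + m)%N -> cmod p.[w ^+ l] <= B) ->
  m%:R * cmod p.[z] ^+ 2 <= (n + m)%:R * B ^+ 2.
Proof.
move=> wP pn /cmod_eq1 z1 pB.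
have : m%:R * `|p.[z]| ^+ 2 <= (n + m)%:R * (B%:C : R[i]) ^+ 2.
  by apply: (sampling wP) => // l lN; rewrite -cmodC lecR pB.
rewrite -cmodC -[m%:R](rmorph_nat (real_complex R)) -[(n + m)%:R](rmorph_nat (real_complex R)).
by rewrite -!rmorphXn -!rmorphM lecR.
Qed.

Lemma circle_sup_norm_sampling n m w (B : R) p : (0 < m)%N ->
  (n + m).-primitive_root w -> (size p <= n.+1)%N ->
  (forall l, (l < n + m)%N -> cmod p.[w ^+ l] <= B) ->
  m%:R * circle_sup_norm p ^+ 2 <= (n + m)%:R * B ^+ 2.
Proof.
move=> m0 wP pn pB.
have B0 : 0 <= B by rewrite (le_trans _ (pB 0%N (prim_order_gt0 wP)))// cmod_ge0.
have m1 : 0 < m%:R :> R by rewrite ltr0n.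
have c0 : 0 <= (n + m)%:R / m%:R * B ^+ 2 by rewrite mulr_ge0// ?divr_ge0// exprn_ge0.
(* The supremum is taken over moduli and not over their squares, so the pointwise bound has to pass
   through a square root. *)
suff h : circle_sup_norm p <= Num.sqrt ((n + m)%:R / m%:R * B ^+ 2).
  have : circle_sup_norm p ^+ 2 <= (n + m)%:R / m%:R * B ^+ 2.
    by rewrite -[leRHS]sqr_sqrtr// lerXn2r ?nnegrE ?sqrtr_ge0// circle_sup_norm_ge0.
  by rewrite mulrAC ler_pdivlMr// mulrC.
apply: circle_sup_norm_le => z z1.
rewrite -[leLHS]ger0_norm ?cmod_ge0// -sqrtr_sqr ler_sqrt//.
by rewrite mulrAC ler_pdivlMr// mulrC (cmod_sampling wP).
Qed.

Lemma circle_sup_norm_bernstein n p : (0 < n)%N -> (size p <= n.+1)%N ->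
  circle_sup_norm p^`() <= 4 * n%:R * circle_sup_norm p.
Proof.
move=> n0 pn; apply: circle_sup_norm_le => z /cmod_eq1 z1.
rewrite -lecR cmodC !rmorphM/= !rmorph_nat.
apply: bernstein_weak => // x /cmod_eq1 x1.
by rewrite -cmodC lecR circle_sup_norm_ge.
Qed.

Lemma circle_sup_norm_rev n p : (size p <= n.+1)%N ->
  circle_sup_norm (rev_poly n p) <= circle_sup_norm p.
Proof.
move=> pn; apply: circle_sup_norm_le => z z1.
have z0 : z != 0 by apply/eqP => z0; move: z1; rewrite z0 -[0]/(0%:R) cmod_nat => /esym/eqP; rewrite oner_eq0.
rewrite rev_poly_horner// cmodM cmodX z1 expr1n mul1r circle_sup_norm_ge//.
by rewrite cmodV z1 invr1.
Qed.

(** On the circle n P(z) splits into z P'(z) and z^n times z^-1 Q'(z^-1), with Q the reversed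
    polynomial; the powers of z have modulus one. *)
Lemma circle_sup_norm_deriv_rev n p : (size p <= n.+1)%N ->
  n%:R * circle_sup_norm p <=
  circle_sup_norm p^`() + circle_sup_norm (rev_poly n p)^`().
Proof.
case: n => [|n] pn; first by rewrite mul0r addr_ge0// circle_sup_norm_ge0.
rewrite -ler_pdivlMl//; apply: circle_sup_norm_le => z z1; rewrite ler_pdivlMl//.
have z0 : z != 0 by apply/eqP => z0; move: z1; rewrite z0 -[0]/(0%:R) cmod_nat => /esym/eqP; rewrite oner_eq0.
have zV : cmod z^-1 = 1 by rewrite cmodV z1 invr1.
have := deriv_rev_poly_horner pn z0 => /(canLR (subrK _)) e.
rewrite -[n.+1%:R in leLHS](cmod_nat n.+1) -cmodM -e.
apply: le_trans (cmodD _ _) _; rewrite addrC lerD//.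
  by rewrite cmodM z1 mul1r circle_sup_norm_ge.
by rewrite !cmodM cmodX z1 zV expr1n !mul1r circle_sup_norm_ge.
Qed.

Lemma bernstein_markov_factor_ge0 p : 0 <= bernstein_markov_factor p.
Proof. by rewrite divr_ge0// circle_sup_norm_ge0. Qed.

Lemma bernstein_markov_factor_le n p : (0 < n)%N -> (size p <= n.+1)%N ->
  bernstein_markov_factor p <= 4 * n%:R.
Proof.
move=> n0 pn; rewrite /bernstein_markov_factor.
have := circle_sup_norm_ge0 p; rewrite le_eqVlt => /predU1P[<-|p0].
  by rewrite invr0 mulr0 mulr_ge0.
by rewrite ler_pdivrMr// circle_sup_norm_bernstein.
Qed.

Lemma bernstein_markov_factor_rev n p : (size p <= n.+1)%N ->
  0 < circle_sup_norm p ->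
  n%:R <= bernstein_markov_factor p + bernstein_markov_factor (rev_poly n p).
Proof.
move=> pn p0.
have q0 : 0 < circle_sup_norm (rev_poly n p).
  rewrite (lt_le_trans p0)//.
  (* Reversal is an involution on polynomials of size at most n + 1, so the one-sided comparison of
     norms works in both directions. *)
  have {1}-> : p = rev_poly n (rev_poly n p).
    apply/polyP => k; rewrite coef_poly; case: ltnP => kn.
      by rewrite coef_poly ltnS leq_subr subKn.
    by rewrite nth_default// (leq_trans pn).
  by apply: circle_sup_norm_rev; exact: size_poly.
apply: (@le_trans _ _ ((circle_sup_norm p^`() + circle_sup_norm (rev_poly n p)^`()) / circle_sup_norm p)).
  by rewrite ler_pdivlMr// circle_sup_norm_deriv_rev.
rewrite mulrDl lerD2l ler_wpM2l ?circle_sup_norm_ge0// lef_pV2//.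
exact: circle_sup_norm_rev.
Qed.

(* Sampling [|z| + X z], whose sup norm is [2 |z|], at the roots of unity. *)
Lemma root_direction L (u z : R[i]) : (0 < L)%N -> L.+1.-primitive_root u ->
  exists l : 'I_L.+1, (1 - 2 / L.+1%:R) * cmod z <= complex.Re (u ^+ l * z).
Proof.
move=> L0 uP.
pose F (l : 'I_L.+1) := complex.Re (u ^+ l * z).
have [l _ lmax] := @arg_maxP _ _ 'I_L.+1 ord0 xpredT F isT.
exists l; have [z0|z0] := eqVneq (cmod z) 0.
  rewrite z0 mulr0.
  have -> : z = 0 by apply/eqP; rewrite -normr_eq0 -cmodC z0.
  by rewrite mulr0.
pose p : {poly R[i]} := (cmod z)%:C%:P + z *: 'X.
have pE x : p.[x] = (cmod z)%:C + x * z by rewrite hornerD hornerC hornerZ hornerX mulrC.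
have pn : (size p <= 2)%N.
  rewrite (leq_trans (size_polyD _ _))// geq_max (leq_trans (size_polyC_leq1 _))//.
  by rewrite (leq_trans (size_scale_leq _ _))// size_polyX.
have sq x : cmod x = 1 -> cmod p.[x] ^+ 2 = 2 * cmod z ^+ 2 + 2 * cmod z * complex.Re (x * z).
  move=> x1; rewrite pE cmod_sqr.
  have := cmod_sqr (x * z); rewrite cmodM x1 mul1r.
  case: (x * z) => a b /= e; rewrite add0r.
  by rewrite (_ : b ^+ 2 = cmod z ^+ 2 - a ^+ 2) ; [ring|rewrite e; ring].
have c0 : 0 < cmod z by rewrite lt_def z0 cmod_ge0.
pose B := Num.sqrt (2 * cmod z ^+ 2 + 2 * cmod z * F l).
have F0 (k : nat) : (k < 1 + L)%N -> 0 <= 2 * cmod z ^+ 2 + 2 * cmod z * complex.Re (u ^+ k * z).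
  by move=> _; rewrite -sq ?exprn_ge0 ?cmod_ge0// cmodX (cmod_prim_root uP) expr1n.
have pB k : (k < 1 + L)%N -> cmod p.[u ^+ k] <= B.
  move=> kL; rewrite -[leLHS]ger0_norm ?cmod_ge0// -sqrtr_sqr sq; last first.
    by rewrite cmodX (cmod_prim_root uP) expr1n.
  rewrite ler_sqrt ?F0// lerD2l ler_wpM2l ?mulr_ge0 ?cmod_ge0//.
  exact: (lmax (Ordinal kL)).
(* At the point |z| / z of the circle the polynomial takes its maximal value 2|z|. With c = |z| and
   f the largest real part, sampling in degree 1 at L + 1 points gives L (2c)^2 <= (L + 1)(2c^2 +
   2cf), which is the claim after division by 2c. *)
have z1 : cmod (z^-1 * (cmod z)%:C) = 1.
  by rewrite cmodM cmodV cmod_real ?cmod_ge0// mulVf.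
have := @cmod_sampling 1 L u _ B p uP pn z1 pB.
rewrite pE mulrAC mulVf ?mul1r; last by rewrite -normr_eq0 -cmodC; apply: contra_neq z0 => -[].
rewrite -rmorphD cmod_real ?addr_ge0 ?cmod_ge0// sqr_sqrtr ?F0//.
rewrite -/(F l) add1n => h; rewrite -(ler_pM2l c0).
set c := cmod z in h *; set f := F l in h *.
have h2 : 0 <= L.+1%:R * (c ^+ 2 + c * f) - L%:R * (2 * c ^+ 2) by lra.
rewrite -subr_ge0 -(pmulr_rge0 _ (ltr0Sn R L)).
rewrite (_ : _ * _ = L.+1%:R * (c ^+ 2 + c * f) - L%:R * (2 * c ^+ 2))//.
by rewrite -natr1; field; rewrite natr1 pnatr_eq0.
Qed.

End ComplexModulus.

Lemma complex_Re_sum (R : realType) (I : Type) (r : seq I) (P : pred I) (F : I -> R[i]) :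
  complex.Re (\sum_(i <- r | P i) F i) = \sum_(i <- r | P i) complex.Re (F i).
Proof. by apply: big_morph => // -[a b] [c e]. Qed.

Lemma complex_Im_sum (R : realType) (I : Type) (r : seq I) (P : pred I) (F : I -> R[i]) :
  complex.Im (\sum_(i <- r | P i) F i) = \sum_(i <- r | P i) complex.Im (F i).
Proof. by apply: big_morph => // -[a b] [c e]. Qed.

Lemma complex_ReM (R : realType) (x y : R[i]) :
  complex.Re (x * y) = complex.Re x * complex.Re y - complex.Im x * complex.Im y.
Proof. by case: x y => [a b] [c e]. Qed.

Lemma complex_ImM (R : realType) (x y : R[i]) :
  complex.Im (x * y) = complex.Re x * complex.Im y + complex.Im x * complex.Re y.
Proof. by case: x y => [a b] [c e]. Qed.

(** * Measurability of the sup norm and of the ratio *)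

Section SupNormMeasurable.
Variables (d : measure_display) (T : measurableType d) (R : realType).
Variables (n : nat) (f : T -> {poly R[i]}).
Hypothesis fn : forall x, (size (f x) <= n.+1)%N.
Hypothesis mRe : forall k, measurable_fun setT (fun x => complex.Re (f x)`_k).
Hypothesis mIm : forall k, measurable_fun setT (fun x => complex.Im (f x)`_k).

Lemma measurable_cmod_horner z : measurable_fun setT (fun x => cmod (f x).[z]).
Proof.
have e x : cmod (f x).[z] = Num.sqrt (
    (\sum_(k < n.+1) (complex.Re (f x)`_k * complex.Re (z ^+ k) -
                      complex.Im (f x)`_k * complex.Im (z ^+ k))) ^+ 2 +
    (\sum_(k < n.+1) (complex.Re (f x)`_k * complex.Im (z ^+ k) +
                      complex.Im (f x)`_k * complex.Re (z ^+ k))) ^+ 2).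
  rewrite -[LHS]ger0_norm ?cmod_ge0// -sqrtr_sqr cmod_sqr (horner_coef_wide _ (fn x)).
  rewrite complex_Re_sum complex_Im_sum; congr (Num.sqrt (_ ^+ 2 + _ ^+ 2)).
    by apply: eq_bigr => k _; rewrite complex_ReM.
  by apply: eq_bigr => k _; rewrite complex_ImM.
under eq_fun do rewrite e.
apply: (measurableT_comp (f := @Num.sqrt R)).
  by apply: continuous_measurable_fun; exact: sqrt_continuous.
apply: measurable_funD; apply: measurable_funX; apply: measurable_sum => k.
  by apply: measurable_funB; apply: measurable_funM.
by apply: measurable_funD; apply: measurable_funM.
Qed.

(** Sampling at n + m + 1 roots of unity loses at most a proportion n / (m + 1), so maxima over
    finite sets converge to the supremum. This makes the uncountable supremum measurable. *)
Lemma circle_sup_norm_limit (w : nat -> R[i]) (p : {poly R[i]}) :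
  (forall m, (n + m.+1).-primitive_root (w m)) -> (size p <= n.+1)%N ->
  (fun m => \big[Order.max/0]_(l < n + m.+1) cmod p.[w m ^+ l]) @ \oo -->
    circle_sup_norm p.
Proof.
move=> wP pn.
pose c := circle_sup_norm p.
have c0 : 0 <= c := circle_sup_norm_ge0 p.
apply: (@squeeze_cvgr _ _ _ _ (fun m => c - c * n%:R * m.+1%:R^-1) (fun=> c)); last exact: cvg_cst.
  apply: nearW => m; set B := \big[_/_]_(_ < _) _.
  have wB l : (l < n + m.+1)%N -> cmod p.[w m ^+ l] <= B.
    by move=> lN; apply: (le_bigmax_cond 0 (fun l : 'I_(n + m.+1) => cmod p.[w m ^+ l]) (j := Ordinal lN)).
  have B0 : 0 <= B by apply: le_trans (wB 0%N _); rewrite ?cmod_ge0 ?addnS.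
  have Bc : B <= c.
    by apply/bigmax_leP; split => // l _; apply: circle_sup_norm_ge;
      rewrite cmodX (cmod_prim_root (wP m)) expr1n.
  apply/andP; split => //.
  have := circle_sup_norm_sampling (ltn0Sn m) (wP m) pn wB.
  rewrite -/c natrD => h.
  have m1 : 0 < m.+1%:R :> R by [].
  have n0 : 0 <= n%:R :> R by [].
  rewrite -(ler_pM2r m1) mulrBl divfK ?gt_eqF//.
  set M := m.+1%:R in h m1 *; set k := n%:R in h n0 *.
  have [cB|cB] := eqVneq (c + B) 0.
    have -> : c = 0 by lra.
    by rewrite mul0r mul0r subr0 mulr_ge0 ?(ltW m1).
  have cB0 : 0 < c + B by rewrite lt_def cB addr_ge0.
  (* Sampling compares squares, and multiplying by [c + B] produces the difference of squares; the
     case [c + B = 0] was set apart for this. *)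
  rewrite -subr_ge0 -(pmulr_rge0 _ cB0).
  have : 0 <= k * (c ^+ 2 + c * B - B ^+ 2) by rewrite mulr_ge0//; nra.
  lra.
have : (fun m : nat => c - c * n%:R * m.+1%:R^-1) @ \oo --> c - c * n%:R * 0.
  apply: cvgB; first exact: cvg_cst.
  by apply: cvgM; [exact: cvg_cst|exact: cvg_harmonic].
by rewrite mulr0 subr0.
Qed.

Lemma measurable_bigmaxr (N : nat) (h : 'I_N -> T -> R) :
  (forall l, measurable_fun setT (h l)) ->
  measurable_fun setT (fun x => \big[Order.max/0]_(l < N) h l x).
Proof.
move=> mh; elim: (index_enum _) => [|l s IH].
  by under eq_fun do rewrite big_nil; exact: measurable_cst.
by under eq_fun do rewrite big_cons; exact: measurable_maxr.
Qed.

Lemma measurable_circle_sup_norm : measurable_fun setT (fun x => circle_sup_norm (f x)).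
Proof.
apply: (@measurable_fun_cvg _ _ _ _ (fun m x =>
    \big[Order.max/0]_(l < n + m.+1) cmod (f x).[chosen_prim_root R (n + m.+1) ^+ l])).
  by move=> m; apply: measurable_bigmaxr => l; exact: measurable_cmod_horner.
move=> x _; apply: (@circle_sup_norm_limit (fun m => chosen_prim_root R (n + m.+1))) => // m.
by apply: chosen_prim_rootP; rewrite addnS.
Qed.

End SupNormMeasurable.

Section FactorMeasurable.
Variables (d : measure_display) (T : measurableType d) (R : realType).
Variables (n : nat) (f : T -> {poly R[i]}).
Hypothesis fn : forall x, (size (f x) <= n.+1)%N.
Hypothesis mRe : forall k, measurable_fun setT (fun x => complex.Re (f x)`_k).
Hypothesis mIm : forall k, measurable_fun setT (fun x => complex.Im (f x)`_k).

Lemma measurable_circle_sup_norm_deriv :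
  measurable_fun setT (fun x => circle_sup_norm (f x)^`()).
Proof.
have ReMn (x : R[i]) k : complex.Re (x *+ k) = complex.Re x *+ k.
  by elim: k => [//|k IH]; rewrite !mulrSr -IH; case: (x *+ k) => a b; case: x {IH}.
have ImMn (x : R[i]) k : complex.Im (x *+ k) = complex.Im x *+ k.
  by elim: k => [//|k IH]; rewrite !mulrSr -IH; case: (x *+ k) => a b; case: x {IH}.
apply: (measurable_circle_sup_norm (n := n)) => [x|k|k].
- exact: size_deriv_leq (leqW (fn x)).
- under eq_fun do rewrite coef_deriv ReMn -mulr_natr.
  exact: measurable_funM.
- under eq_fun do rewrite coef_deriv ImMn -mulr_natr.
  exact: measurable_funM.
Qed.

Lemma measurable_bernstein_markov_factor :
  measurable_fun setT (fun x => bernstein_markov_factor (f x)).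
Proof.
apply: measurable_funM; first exact: measurable_circle_sup_norm_deriv.
(* The inverse is written as the power -1, a measurable function that agrees with it at 0 too. *)
under eq_fun do rewrite -powR_inv1 ?circle_sup_norm_ge0//.
exact: (measurableT_comp (measurable_powR (-1)) (measurable_circle_sup_norm fn mRe mIm)).
Qed.

End FactorMeasurable.

(** * Independent Gaussian variables *)

Import HBNNSimple.
Local Open Scope ereal_scope.

Section IntegralTransfer.
Context d1 d2 d' (T1 : measurableType d1) (T2 : measurableType d2) (T' : measurableType d') (R : realType).
Variables (mu1 : {measure set T1 -> \bar R}) (mu2 : {measure set T2 -> \bar R}).
Variables (w1 : T1 -> R) (w2 : T2 -> R) (Y1 : T1 -> T') (Y2 : T2 -> T').
Hypotheses (w1_ge0 : forall x, (0 <= w1 x)%R) (w2_ge0 : forall x, (0 <= w2 x)%R).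
Hypotheses (mw1 : measurable_fun setT w1) (mw2 : measurable_fun setT w2).
Hypotheses (mY1 : measurable_fun setT Y1) (mY2 : measurable_fun setT Y2).

Lemma integral_weighted_nnsfun d (T : measurableType d) (mu : {measure set T -> \bar R})
    (w : T -> R) (Y : T -> T') (g : {nnsfun T' >-> R}) :
  (forall x, 0 <= w x)%R -> measurable_fun setT w -> measurable_fun setT Y ->
  \int[mu]_x ((w x)%:E * (g (Y x))%:E) =
  \sum_(y \in range g) y%:E * \int[mu]_x ((w x)%:E * (\1_(g @^-1` [set y]) (Y x))%:E).
Proof.
move=> w0 mw mY.
have ind0 y x : 0 <= y%:E * (\1_(g @^-1` [set y]) (Y x))%:E by exact: nnfun_muleindic_ge0.
have mI y : measurable_fun setT (fun x => (w x)%:E * (\1_(g @^-1` [set y]) (Y x))%:E).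
  apply: emeasurable_funM; apply/measurable_EFinP => //.
  by apply: (measurableT_comp _ mY); exact: measurable_indic.
transitivity (\int[mu]_x \sum_(y \in range g) (y%:E * ((w x)%:E * (\1_(g @^-1` [set y]) (Y x))%:E))).
  apply: eq_integral => x _; rewrite fimfunE -fsumEFin// ge0_mule_fsumr.
    by apply: eq_fsbigr => y _; rewrite EFinM muleCA.
  by move=> y; rewrite EFinM.
rewrite ge0_integral_fsum//; last 2 first.
  - by move=> y; apply: measurable_funeM.
  - by move=> y x _; rewrite muleCA; apply: mule_ge0 => //; rewrite lee_fin.
apply: eq_fsbigr => y /[!inE] -[x _ <-].
by rewrite ge0_integralZl_EFin// => z _; rewrite mule_ge0 ?lee_fin//.
Qed.

(** The hypothesis says that the weighted measures have the same image under [Y1] and [Y2]; simple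
    functions and monotone limits extend this to [h]. Having weights on both sides lets the
    statement serve both for a density and for isolating one factor of an independent product. *)
Lemma integral_transfer (h : T' -> R) :
  (forall B, measurable B -> \int[mu1]_x ((w1 x)%:E * (\1_B (Y1 x))%:E) =
                             \int[mu2]_x ((w2 x)%:E * (\1_B (Y2 x))%:E)) ->
  (forall y, (0 <= h y)%R) -> measurable_fun setT h ->
  \int[mu1]_x ((w1 x)%:E * (h (Y1 x))%:E) = \int[mu2]_x ((w2 x)%:E * (h (Y2 x))%:E).
Proof.
move=> wB h0 mh.
have mEh : measurable_fun setT (EFin \o h) by exact/measurable_EFinP.
pose f_ := nnsfun_approx measurableT mEh.
have lim d (T : measurableType d) (mu : {measure set T -> \bar R}) (w : T -> R) (Y : T -> T') :
    (forall x, 0 <= w x)%R -> measurable_fun setT w -> measurable_fun setT Y ->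
    \int[mu]_x ((w x)%:E * (h (Y x))%:E) = limn (fun n => \int[mu]_x ((w x)%:E * (f_ n (Y x))%:E)).
  move=> w0 mw mY; rewrite -monotone_convergence//.
  - apply: eq_integral => x _; apply/esym/cvg_lim => //.
    have hc : EFin \o f_^~ (Y x) @ \oo --> (EFin \o h) (Y x).
      by apply: cvg_nnsfun_approx => // y _ /=; rewrite lee_fin.
    have fx0 n : 0 <= (f_ n (Y x))%:E by rewrite lee_fin.
    by apply: cvgeMl.
  - move=> n; apply: emeasurable_funM; apply/measurable_EFinP => //.
    by apply: (measurableT_comp _ mY).
  - by move=> n x _; rewrite mule_ge0 ?lee_fin//.
  - by move=> x _ m n mn; rewrite lee_wpmul2l ?lee_fin//; exact/lefP/nd_nnsfun_approx.
rewrite !lim//; congr (limn _); apply/funext => n.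
by rewrite !integral_weighted_nnsfun//; apply: eq_fsbigr => y _; rewrite wB.
Qed.
End IntegralTransfer.

Section IndependentProduct.
Context d d' (T : measurableType d) (T' : measurableType d') (R : realType).
Variables (P : probability T R) (N : nat) (X : nat -> T -> T').
Hypothesis mX : forall k, measurable_fun setT (X k).
Hypothesis indep : forall B : nat -> set T', (forall k, measurable (B k)) ->
  P (\bigcap_(k in `I_N) X k @^-1` B k) = \prod_(k < N) P (X k @^-1` B k).

Lemma integral_prod_indep (g : nat -> T' -> R) (e : nat -> R) :
  (forall k y, (0 <= g k y)%R) -> (forall k, measurable_fun setT (g k)) ->
  (forall k, \int[P]_w (g k (X k w))%:E = (e k)%:E) ->
  \int[P]_w (\prod_(k < N) g k (X k w))%:E = (\prod_(k < N) e k)%:E.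
Proof.
pose ind (g : nat -> T' -> R) k := exists2 B, measurable B & g k = \1_B.
(* Induction on j: the factors of index below j are arbitrary, those from j on are indicators. For j
   = 0 this is independence of events, for j = N it is the goal. *)
suff claim j : forall (g : nat -> T' -> R) (e : nat -> R),
  (forall k y, (0 <= g k y)%R) -> (forall k, measurable_fun setT (g k)) ->
  (forall k, \int[P]_w (g k (X k w))%:E = (e k)%:E) ->
  (forall k, (j <= k < N)%N -> ind g k) ->
  \int[P]_w (\prod_(k < N) g k (X k w))%:E = (\prod_(k < N) e k)%:E.
  move=> g0 mg ge; apply: (claim N) => // k /andP[Nk kN].
  by move: (leq_ltn_trans Nk kN); rewrite ltnn.
elim: j => [|j IH] {}g {}e g0 mg ge gind.
  have [B HB] : {B : nat -> set T' & forall k, measurable (B k) /\ ((k < N)%N -> g k = \1_(B k))}.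
    apply: (@choice _ _ (fun k B => measurable B /\ ((k < N)%N -> g k = \1_B))) => k.
    have [kN|] := ltnP k N; last by exists setT.
    by have [|B mB gB] := gind k; [exact: kN|exists B].
  transitivity (\int[P]_w (\1_(\bigcap_(k in `I_N) X k @^-1` B k) w)%:E).
    apply: eq_integral => w _; congr (_%:E).
    rewrite indicE; have [wB|wB] := boolP (w \in _).
      move: wB; rewrite inE => wB; rewrite big1// => k _.
      by rewrite (HB k).2// indicE mem_set//; exact: wB (ltn_ord k).
    move: wB; rewrite notin_setE => /existsNP[k /not_implyP[kN kB]].
    by rewrite (bigD1 (Ordinal kN))//= (HB k).2// indicE memNset// mul0r.
  have mB k : measurable (X k @^-1` B k).
    by rewrite -[X in measurable X]setTI; apply: mX => //; exact: (HB k).1.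
  rewrite integral_indic ?setIT//; last by apply: bigcap_measurableType => k _; exact: mB.
  apply: etrans (indep (fun k => (HB k).1)) _.
  rewrite -prodEFin; apply: eq_bigr => k _.
  rewrite -ge (HB k).2//; rewrite -[LHS](_ : \int[P]_w (\1_(X k @^-1` B k) w)%:E = _)//.
  by rewrite integral_indic// setIT.
have [Nj|jN] := leqP N j.
  apply: IH => // k /andP[jk kN]; apply: gind.
  by move: (leq_ltn_trans jk kN); rewrite ltnNge Nj.
pose J := Ordinal jN.
rewrite (bigD1 J)//=.
pose w1 w := (\prod_(k < N | k != J) g k (X k w))%R.
pose c := (\prod_(k < N | k != J) e k)%R.
have e0 k : (0 <= e k)%R by rewrite -lee_fin -ge integral_ge0// => w _; rewrite lee_fin.
have c0 : (0 <= c)%R by rewrite prodr_ge0.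
have mw1 : measurable_fun setT w1.
  rewrite (_ : w1 = fun w => (\prod_(k < N) (if k != J then g k (X k w) else 1))%R); last first.
    by apply/funext => w; rewrite /w1 big_mkcond.
  by apply: measurable_prod => k _; case: (k != J) => //; exact: measurableT_comp.
transitivity (\int[P]_w ((w1 w)%:E * (g j (X j w))%:E)).
  by apply: eq_integral => w _; rewrite (bigD1 J)//= mulrC EFinM.
(* Factor [j] is isolated: the other factors form the weight [w1], which is compared with the
   constant weight [c]. When factor [j] is an indicator, the comparison is the induction
   hypothesis. *)
rewrite (@integral_transfer _ _ _ _ _ _ _ P P w1 (cst c) (X j) (X j))//.
- rewrite ge0_integralZl_EFin//.
  + by rewrite ge -EFinM mulrC.
  + by move=> w _; rewrite lee_fin.
  + by apply/measurable_EFinP; exact: measurableT_comp.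
- by move=> w; rewrite prodr_ge0.
- move=> B mB.
  pose g' k := if k == j then \1_B else g k.
  pose b := fine (P (X j @^-1` B)).
  pose e' k := if k == j then b else e k.
  have mXB : measurable (X j @^-1` B) by rewrite -[X in measurable X]setTI; exact: mX.
  have PB : \int[P]_w (\1_B (X j w))%:E = b%:E.
    rewrite -[LHS]/(\int[P]_w (\1_(X j @^-1` B) w)%:E) integral_indic// setIT.
    by rewrite fineK// fin_num_measure.
  have offJ (F G : nat -> R) : (forall k, k != j -> F k = G k) ->
      (\prod_(k < N | k != J) F k = \prod_(k < N | k != J) G k)%R.
    by move=> FG; apply: eq_bigr => k kJ; apply: FG; rewrite -(inj_eq val_inj) in kJ.
  rewrite ge0_integralZl_EFin//; last first.
    by apply/measurable_EFinP; apply: measurableT_comp => //; exact: measurable_indic.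
  rewrite PB -EFinM.
  transitivity (\int[P]_w (\prod_(k < N) g' k (X k w))%:E).
    apply: eq_integral => w _; rewrite [RHS](congr1 EFin (bigD1 J _))//= {1}/g' eqxx mulrC EFinM.
    congr (_%:E * _).
    by apply: (offJ (fun k => g k (X k w)) (fun k => g' k (X k w))) => k /negbTE kj; rewrite /g' kj.
  rewrite (IH g' e').
  + rewrite (bigD1 J)//= {1}/e' eqxx (offJ e' e) 1?mulrC//.
    by move=> k /negbTE kj; rewrite /e' kj.
  + by move=> k y; rewrite /g'; case: ifP => _; [rewrite indicE|].
  + by move=> k; rewrite /g'; case: ifP => _; [exact: measurable_indic|].
  + by move=> k; rewrite /g' /e'; case: eqP => [->|_].
  + move=> k; rewrite leq_eqVlt => /andP[/predU1P[<-|jk] kN].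
      by exists B => //; rewrite /g' eqxx.
    by rewrite /ind /g' gt_eqF//; apply: gind; rewrite jk.
Qed.

End IndependentProduct.

(** Completing the square: tilting by [expR (c * x)] moves the mean to [c * s ^+ 2] and leaves a
    constant factor. *)
Lemma normal_mgf (R : realType) (c s : R) : (s != 0)%R ->
  \int[@lebesgue_measure R]_x (expR (c * x) * normal_pdf 0 s x)%:E =
  (expR (c ^+ 2 * s ^+ 2 / 2))%:E.
Proof.
move=> s0.
transitivity (\int[@lebesgue_measure R]_x ((expR (c ^+ 2 * s ^+ 2 / 2))%:E * (normal_pdf (c * s ^+ 2) s x)%:E)).
  apply: eq_integral => x _; rewrite -EFinM !normal_pdfE//; congr (_%:E).
  rewrite mulrCA [RHS]mulrCA; congr (_ * _)%R; rewrite -!expRD; congr expR.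
  by rewrite -mulr_natr; field.
rewrite ge0_integralZl_EFin//.
- by rewrite integral_normal_pdf mule1.
- by move=> x _; rewrite lee_fin normal_pdf_ge0.
- by apply/measurable_EFinP; exact: measurable_normal_pdf.
Qed.

(** * The standard complex normal distribution *)

Section ComplexMeasurable.
Variable R : realType.

Lemma measurable_complex_pair : measurable_fun setT (@complex_pair R).
Proof. by move=> _ B mB; rewrite setTI; exists B => //; rewrite setTI. Qed.

Lemma measurable_Re : measurable_fun setT (@complex.Re R : R[i] -> R).
Proof. exact: (measurableT_comp (f := fst)) measurable_complex_pair. Qed.

Lemma measurable_Im : measurable_fun setT (@complex.Im R : R[i] -> R).
Proof. exact: (measurableT_comp (f := snd)) measurable_complex_pair. Qed.

Lemma measurable_Complex : measurable_fun setT (fun p : R * R => p.1 +i* p.2).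
Proof.
move=> _ _ [B mB <-]; rewrite !setTI.
by rewrite (_ : _ @^-1` _ = B)//; apply/funext => -[].
Qed.

Lemma measurable_expR_Re (a : R[i]) :
  measurable_fun setT (fun z : R[i] => expR (complex.Re (a * z)%R)).
Proof.
under eq_fun do rewrite complex_ReM.
apply: (measurableT_comp (f := @expR R)) => //.
by apply: measurable_funB; apply: measurable_funM => //; [exact: measurable_Re|exact: measurable_Im].
Qed.

(** The standard deviation of the real and of the imaginary part, whose variances are 1/2 each. *)
Let s : R := Num.sqrt 2^-1.

Lemma complex_normal_pdfE (x y : R) :
  complex_normal_pdf (x +i* y) = (normal_pdf 0 s x * normal_pdf 0 s y)%R.
Proof.
have s2 : (s ^+ 2 = 2^-1)%R by rewrite sqr_sqrtr.
have s0 : (s != 0)%R by rewrite gt_eqF// sqrtr_gt0.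
rewrite /complex_normal_pdf cmod_sqr/= !normal_pdfE// /normal_peak /normal_fun s2.
have -> : (2^-1 * pi *+ 2 = pi :> R)%R by rewrite -[LHS]mulr_natr; field.
have -> : (2^-1 *+ 2 = 1 :> R)%R by rewrite -[LHS]mulr_natr; field.
rewrite !subr0 !divr1 mulrACA -expRD -opprD; congr (_ * _)%R.
by rewrite -invfM -expr2 sqr_sqrtr// pi_ge0.
Qed.

Lemma measurable_complex_normal_pdf :
  measurable_fun setT (fun p : R * R => complex_normal_pdf (p.1 +i* p.2)).
Proof.
under eq_fun do rewrite complex_normal_pdfE.
by apply: measurable_funM; apply: (measurableT_comp (@measurable_normal_pdf R 0 s)).
Qed.

(** The law gives an integral over the plane, the density factors, and Re (a z) = a1 x - a2 y
    separates the variables; each real integral contributes a_i^2 / 4 to the exponent. *)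
Lemma complex_normal_mgf d (T : measurableType d) (P : probability T R)
    (Z : T -> R[i]) (a : R[i]) : measurable_fun setT Z ->
  (forall B, measurable B -> P (Z @^-1` B) = complex_normal_prob B) ->
  \int[P]_w (expR (complex.Re (a * Z w)%R))%:E = (expR (cmod a ^+ 2 / 4))%:E.
Proof.
move=> mZ ZP.
have pdf0 (p : R * R) : (0 <= complex_normal_pdf (p.1 +i* p.2))%R.
  by rewrite complex_normal_pdfE mulr_ge0 ?normal_pdf_ge0.
pose mu2 := (@lebesgue_measure R \x @lebesgue_measure R) : {measure set _ -> \bar R}.
have := @integral_transfer _ _ _ T _ R[i] R P mu2
  (cst 1%R) (fun p : R * R => complex_normal_pdf (p.1 +i* p.2)) Z (fun p => p.1 +i* p.2) _ _ _ _ mZ measurable_Complex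
  (fun z => expR (complex.Re (a * z)%R)).
move=> /(_ _ _ _ _ _ _ (measurable_expR_Re a)) h.
under eq_integral do rewrite -[_%:E]mul1e.
rewrite h//; last 2 first.
- exact: measurable_complex_normal_pdf.
- move=> B mB; under eq_integral do rewrite mul1e.
  have mZB : measurable (Z @^-1` B) by rewrite -[X in measurable X]setTI; exact: mZ.
  rewrite -[LHS]/(\int[P]_w (\1_(Z @^-1` B) w)%:E) integral_indic// setIT.
  rewrite [LHS]ZP// /complex_normal_prob [LHS]integral_mkcond; apply: eq_integral => p _.
  rewrite patchE indicE; have [pB|pB] := boolP (p \in _).
    by rewrite mem_set ?mule1//; move: pB; rewrite inE.
  by rewrite memNset ?mule0//; move: pB; rewrite notin_setE.
have s2 : (s ^+ 2 = 2^-1)%R by rewrite sqr_sqrtr.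
have s0 : (s != 0)%R by rewrite gt_eqF// sqrtr_gt0.
case: a h => a1 a2 _.
pose F (c : R) x := (expR (c * x) * normal_pdf 0 s x)%R.
have F0 c x : (0 <= F c x)%R by rewrite mulr_ge0 ?expR_ge0 ?normal_pdf_ge0.
have mF c : measurable_fun setT (F c).
  apply: measurable_funM; last exact: measurable_normal_pdf.
  by apply: measurableT_comp => //; exact: measurable_funM.
transitivity (\int[mu2]_p (F a1 p.1 * F (- a2) p.2)%:E).
  apply: eq_integral => -[x y] _; rewrite -EFinM complex_normal_pdfE complex_ReM/= -mulNr expRD /F.
  by congr (_%:E); rewrite mulrC mulrACA.
rewrite fubini_tonelli1/=; last 2 first.
- apply/measurable_EFinP; apply: measurable_funM.
    exact: (measurableT_comp (mF a1)).
  exact: (measurableT_comp (mF _)).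
- by move=> p; rewrite lee_fin mulr_ge0.
rewrite /fubini_F/=.
have mEF c : measurable_fun setT (EFin \o F c) by exact/measurable_EFinP.
have intF c := normal_mgf c s0.
transitivity (\int[lebesgue_measure]_x ((F a1 x)%:E * (expR ((- a2) ^+ 2 * s ^+ 2 / 2))%:E)).
  apply: eq_integral => x _; rewrite -intF.
  rewrite -ge0_integralZl_EFin//.
  - by move=> y _; rewrite lee_fin F0.
  - exact: (mEF (- a2)%R).
rewrite ge0_integralZr//.
- rewrite [X in X * _]intF -EFinM -expRD cmod_sqr/= s2; congr (expR _)%:E.
  by rewrite sqrrN; field.
- exact: (mEF a1).
- by move=> y _; rewrite lee_fin F0.
Qed.

End ComplexMeasurable.

Local Close Scope ereal_scope.

Section GaussianSequence.
Context (R : realType) (d : measure_display) (T : measurableType d).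
Variables (P : probability T R) (A : nat -> {RV P >-> R[i]}).
Hypothesis A_indep : mutually_independent A.

Lemma mutually_independent_prefix (N : nat) (B : nat -> set R[i]) :
  (forall k, measurable (B k)) ->
  P (\bigcap_(k in `I_N) A k @^-1` B k) = (\prod_(k < N) P (A k @^-1` B k))%E.
Proof.
move=> mB; pose J := [fset k in iota 0 N]%fset.
have := A_indep J mB.
have -> : [set` J] = `I_N.
  by apply/seteqP; split=> k /=; rewrite !inE mem_iota add0n leq0n.
move=> ->; rewrite -(big_mkord xpredT (fun k => P (A k @^-1` B k))).
apply: perm_big; rewrite /index_iota subn0; apply: uniq_perm => //; first exact: iota_uniq.
by move=> k; rewrite inE.
Qed.

Hypothesis A_normal : forall (k : nat) (B : set R[i]), measurable B ->
  distribution P (A k) B = complex_normal_prob B.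

(** The exponential turns the sum into a product of functions of independent coefficients, and the
    exponents of their means add up. *)
Lemma gaussian_sum_mgf (N : nat) (a : nat -> R[i]) :
  (\int[P]_w (expR (complex.Re (\sum_(k < N) a k * A k w)%R))%:E =
  (expR ((\sum_(k < N) cmod (a k) ^+ 2) / 4))%:E)%E.
Proof.
have h := @integral_prod_indep _ _ T R[i] R P N (fun k => A k) (fun k => measurable_funPT (A k))
   (@mutually_independent_prefix N) (fun k z => expR (complex.Re (a k * z)))
   (fun k => expR (cmod (a k) ^+ 2 / 4)).
transitivity (\int[P]_w (\prod_(k < N) expR (complex.Re (a k * A k w)))%:E)%E.
  by apply: eq_integral => w _; rewrite complex_Re_sum expR_sum.
rewrite {}h.
- by rewrite -expR_sum mulr_suml.
- by move=> k y; exact: expR_ge0.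
- by move=> k; exact: measurable_expR_Re.
- by move=> k; apply: complex_normal_mgf => // B mB; exact: A_normal.
Qed.

End GaussianSequence.

(** * Equality of laws of tuples *)

Section TupleLaw.
Context d d' (T : measurableType d) (T' : measurableType d') (R : realType).
Variables (P : probability T R) (N : nat).

Let rectangle : set (set (N.-tuple T')) :=
  [set S | exists2 B : 'I_N -> set T', (forall i, measurable (B i)) &
    S = \bigcap_i ((fun t => tnth t i) @^-1` B i)].

Lemma measurable_tuple_rectangle : measurable = <<s rectangle >>.
Proof.
apply/seteqP; split => S.
  move=> mS; apply: (mS <<s rectangle >>); split; first exact: smallest_sigma_algebra.
  move=> U; rewrite -bigcup_seq => -[i _ [B mB <-]]; apply: sub_sigma_algebra.
  (* A generator constrains a single coordinate, so it is a rectangle whose other sides are full. *)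
  exists (fun k => if k == i then B else setT) => [k|]; first by case: ifP.
  rewrite setTI; apply/seteqP; split => [t /= tB k _|t tB].
    by case: eqP => [->|].
  by have := tB i Logic.I; rewrite /= eqxx.
move=> mS; apply: (mS measurable); split; first exact: sigma_algebra_measurable.
move=> _ [B mB ->]; apply: fin_bigcap_measurable => // i _.
by rewrite -[X in measurable X]setTI; apply: measurable_tnth.
Qed.

(** Rectangles form a pi-system generating the sigma-algebra, so agreement on them forces the two
    joint laws to coincide, and the integral of [F] depends on the law alone. *)
Lemma tuple_law_unique (X Y : 'I_N -> T -> T') (F : N.-tuple T' -> \bar R) :
  (forall i, measurable_fun setT (X i)) -> (forall i, measurable_fun setT (Y i)) ->
  (forall B : 'I_N -> set T', (forall i, measurable (B i)) ->
    P (\bigcap_i (X i @^-1` B i)) = P (\bigcap_i (Y i @^-1` B i))) ->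
  measurable_fun setT F -> (forall t, 0 <= F t)%E ->
  (\int[P]_w F [tuple X i w | i < N] = \int[P]_w F [tuple Y i w | i < N])%E.
Proof.
move=> mX mY XY mF F0.
have mt (Z : 'I_N -> T -> T') : (forall i, measurable_fun setT (Z i)) ->
    measurable_fun setT (fun w => [tuple Z i w | i < N]).
  move=> mZ; apply/measurable_fun_tnthP => i.
  by rewrite (_ : _ \o _ = Z i)//; apply/funext => w /=; rewrite tnth_mktuple.
pose pack Z mZ : {mfun T >-> N.-tuple T'} :=
  HB.pack (fun w => [tuple Z i w | i < N]) (isMeasurableFun.Build _ _ _ _ _ (mt Z mZ)).
have law Z mZ : (\int[P]_w F [tuple Z i w | i < N] = \int[distribution P (pack Z mZ)]_t F t)%E.
  by rewrite ge0_integral_distribution.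
rewrite (law X mX) (law Y mY); apply: eq_measure_integral => S mS _.
apply: (measure_unique rectangle (fun=> setT)) => //.
- exact: measurable_tuple_rectangle.
- move=> _ _ [B mB ->] [C mC ->]; exists (fun i => B i `&` C i) => [i|]; first exact: measurableI.
  by rewrite bigcapI.
- by move=> _; exists (fun=> setT) => //; rewrite bigcapT.
- by rewrite bigcup_const.
- move=> _ [B mB ->].
  have cap Z mZ : distribution P (pack Z mZ) (\bigcap_i ((fun t => tnth t i) @^-1` B i)) = P (\bigcap_i (Z i @^-1` B i)).
    congr (P _); apply/seteqP; split => w /= wB i _; have := wB i Logic.I; by rewrite /= tnth_mktuple.
  by apply: etrans (cap X mX) _; apply: etrans (XY B mB) _; apply: esym (cap Y mY).
- by move=> _; apply: le_lt_trans (probability_le1 _ _) _ => //; exact: ltry.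
Qed.

End TupleLaw.

(** * Concentration *)

(* Let V_j be expR (lam * x j) if al < x j <= be and 0 otherwise; the sum of the
   V_j vanishes when b holds, and the inequality bounds (\sum_j V_j - mu) ^+ 2 by
   exponentials only, whose means are explicit for Gaussian x j. *)
Lemma truncated_second_moment (R : realType) (m : nat) (x : 'I_m -> R)
    (lam eps al be mu : R) (b : bool) :
  0 <= lam -> 0 <= eps -> 0 <= mu -> (b -> forall j, x j <= al) ->
  mu ^+ 2 * b%:R + 2 * mu * \sum_j expR (lam * x j) <=
  \sum_j \sum_(k | k != j) expR (lam * x j + lam * x k) +
  \sum_j expR (lam * x j + lam * be) +
  2 * mu * (\sum_j expR (lam * x j + eps * (al - x j)) +
            \sum_j expR (lam * x j + eps * (x j - be))) + mu ^+ 2.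
Proof.
move=> lam0 eps0 mu0 bx.
pose V j := if (al < x j) && (x j <= be) then expR (lam * x j) else 0.
have V0 j : 0 <= V j by rewrite /V; case: ifP => // _; exact: expR_ge0.
have VU j : V j <= expR (lam * x j) by rewrite /V; case: ifP => // _; exact: expR_ge0.
(* The truncation at [be] matters on the diagonal only, where it bounds one of the two factors by
   [expR (lam * be)]; off the diagonal both factors are replaced by their untruncated values. *)
have hV2 : (\sum_j V j) ^+ 2 <= \sum_j \sum_(k | k != j) expR (lam * x j + lam * x k) +
    \sum_j expR (lam * x j + lam * be).
  rewrite expr2 mulr_suml -big_split/=; apply: ler_sum => j _.
  rewrite mulr_sumr (bigD1 j)//= addrC; apply: lerD.
    by apply: ler_sum => k _; rewrite expRD ler_pM.
  rewrite expRD; apply: ler_pM => //; rewrite /V; case: ifP => [/andP[_ h]|_]; last exact: expR_ge0.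
  by rewrite ler_expR ler_wpM2l.
(* A discarded index has [x j <= al] or [be < x j], and the corresponding correction factor is then
   at least 1. *)
have hV1 : \sum_j expR (lam * x j) <= \sum_j V j + (\sum_j expR (lam * x j + eps * (al - x j)) +
            \sum_j expR (lam * x j + eps * (x j - be))).
  rewrite -!big_split/=; apply: ler_sum => j _; rewrite /V.
  have [h1|h1] := ltP al (x j); have [h2|h2] := leP (x j) be => //=;
    rewrite ?lerDl ?addr_ge0 ?expR_ge0// add0r.
  - by rewrite ler_wpDl ?expR_ge0// ler_expR lerDl mulr_ge0// subr_ge0 ltW.
  - by rewrite ler_wpDr ?expR_ge0// ler_expR lerDl mulr_ge0// subr_ge0.
  - by rewrite ler_wpDr ?expR_ge0// ler_expR lerDl mulr_ge0// subr_ge0.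
have hb : mu ^+ 2 * b%:R <= (\sum_j V j - mu) ^+ 2.
  case: b bx => bx; last by rewrite mulr0 sqr_ge0.
  rewrite big1 ?sub0r ?sqrrN ?mulr1// => j _.
  by rewrite /V ltNge bx.
have := ler_wpM2l mu0 hV1.
move: hV2 hb; rewrite mulrDr.
set S2 := \sum_j \sum_(_ | _) _; set SV := \sum_j V j.
set SU := \sum_j expR (lam * x j); set Sb := \sum_j expR (lam * x j + lam * be).
set Sl := \sum_j expR (lam * x j + eps * (al - x j)) + _.
(* Once the square of the sum minus [mu] is expanded, its cross term calls for a lower bound on the
   truncated sum, which is [hV1] multiplied by [mu]. *)
by move=> h1 h2 h3; nra.
Qed.

Section Concentration.
Context (R : realType) (d : measure_display) (T : measurableType d).
Variables (P : probability T R) (A : nat -> {RV P >-> R[i]}).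
Hypothesis A_indep : mutually_independent A.
Hypothesis A_normal : forall (k : nat) (B : set R[i]), measurable B ->
  distribution P (A k) B = complex_normal_prob B.

Definition lin_comb N (a : nat -> R[i]) w : R[i] := \sum_(k < N) a k * A k w.

Lemma measurable_Re_lin_comb N a : measurable_fun setT (fun w => complex.Re (lin_comb N a w)).
Proof.
rewrite /lin_comb; under eq_fun do rewrite complex_Re_sum.
apply: measurable_sum => k; under eq_fun do rewrite complex_ReM.
have mA := @measurable_funPT _ _ _ _ (A k).
apply: measurable_funB; apply: measurable_funM => //.
  exact: (measurableT_comp (@measurable_Re R) mA).
exact: (measurableT_comp (@measurable_Im R) mA).
Qed.

Lemma measurable_exp_lin_comb N a r :
  measurable_fun setT (fun w => expR (complex.Re (lin_comb N a w) + r)).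
Proof.
apply: (measurableT_comp (f := @expR R)) => //.
by apply: measurable_funD => //; exact: measurable_Re_lin_comb.
Qed.

Lemma integral_exp_lin_comb N a r :
  (\int[P]_w (expR (complex.Re (lin_comb N a w) + r))%:E =
  (expR ((\sum_(k < N) cmod (a k) ^+ 2) / 4 + r))%:E)%E.
Proof.
under eq_integral do rewrite expRD EFinM.
rewrite ge0_integralZr//.
- by rewrite gaussian_sum_mgf// expRD EFinM.
- apply/measurable_EFinP.
  under eq_fun do rewrite -[complex.Re _]addr0.
  exact: measurable_exp_lin_comb.
Qed.

Lemma integral_sum_exp_lin_comb (I : Type) (s : seq I) (Q : pred I) N (a : I -> nat -> R[i]) (r : I -> R) :
  (\int[P]_w (\sum_(i <- s | Q i) expR (complex.Re (lin_comb N (a i) w) + r i))%:E =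
   (\sum_(i <- s | Q i) expR ((\sum_(k < N) cmod (a i k) ^+ 2) / 4 + r i))%:E)%E.
Proof.
under eq_integral do rewrite -sumEFin -big_filter.
rewrite ge0_integral_sum//.
- by rewrite big_filter -sumEFin; apply: eq_bigr => i _; exact: integral_exp_lin_comb.
- by move=> i; apply/measurable_EFinP; exact: measurable_exp_lin_comb.
Qed.

Lemma measurable_sum_exp_lin_comb (I : Type) (s : seq I) (Q : pred I) N (a : I -> nat -> R[i]) (r : I -> R) :
  measurable_fun setT (fun w => \sum_(i <- s | Q i) expR (complex.Re (lin_comb N (a i) w) + r i)).
Proof.
under eq_fun do rewrite -big_filter.
by apply: measurable_sum => i; exact: measurable_exp_lin_comb.
Qed.

Lemma lin_combZ N c a w : lin_comb N (fun k => c * a k) w = c * lin_comb N a w.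
Proof. by rewrite /lin_comb mulr_sumr; apply: eq_bigr => k _; rewrite mulrA. Qed.

(** Union bound over G combinations and L + 1 directions: a modulus of at least t forces a real part
    of at least (1 - 2 / (L + 1)) t in some direction, where the exponential Markov inequality
    applies. *)
Lemma max_lin_comb_tail (G N L : nat) (a : 'I_G -> nat -> R[i]) (sig2 t : R) (E : set T) :
  0 < sig2 -> 0 <= t -> (0 < L)%N ->
  (forall l, \sum_(k < N) cmod (a l k) ^+ 2 = sig2) ->
  measurable E ->
  (forall w, E w -> exists l, t <= cmod (lin_comb N (a l) w)) ->
  (P E <= (G%:R * (L.+1%:R * expR (- ((1 - 2 / L.+1%:R) * t) ^+ 2 / sig2)))%:E)%E.
Proof.
move=> sig0 t0 L0 asig mE Et.
have [u uP] := prim_root_exists R[i] (ltn0Sn L).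
set c := (1 - 2 / L.+1%:R).
have c0 : 0 <= c by rewrite /c subr_ge0 ler_pdivrMr// mul1r ler_nat.
(* The minimiser of the exponent lam^2 sig2 / 4 - lam c t, whose minimum is - (c t)^2 / sig2. *)
pose lam := 2 * (c * t) / sig2.
have lam0 : 0 <= lam by rewrite /lam divr_ge0// ?(ltW sig0)// !mulr_ge0.
pose f w : R := \sum_(l < G) \sum_(i < L.+1)
   expR (complex.Re (lin_comb N (fun k => (lam%:C * u ^+ i) * a l k) w) + - (lam * (c * t))).
have mf : measurable_fun setT f.
  by apply: measurable_sum => l; apply: (@measurable_sum_exp_lin_comb 'I_L.+1).
have f0 w : 0 <= f w by apply: sumr_ge0 => l _; apply: sumr_ge0 => i _; exact: expR_ge0.
have Ef w : \1_E w <= f w.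
  rewrite indicE; have [wE|_] := boolP (w \in E); last exact: f0.
  move: wE; rewrite inE => /Et[l tl].
  have [i hi] := root_direction (lin_comb N (a l) w) L0 uP.
  rewrite /f (bigD1 l)//= (bigD1 i)//= -addrA ler_wpDr//.
    by rewrite addr_ge0 ?sumr_ge0// => *; rewrite ?sumr_ge0// => *; exact: expR_ge0.
  rewrite -[leLHS]expR0 ler_expR lin_combZ -mulrA.
  rewrite complex_ReM/= mul0r subr0 -mulrBr mulr_ge0// subr_ge0.
  by apply: le_trans hi; rewrite ler_wpM2l.
apply: (@le_trans _ _ (\int[P]_w (f w)%:E)%E).
  rewrite -[E]setIT -integral_indic//; apply: ge0_le_integral => //.
  - by apply/measurable_EFinP; exact: measurable_indic.
  - by apply/measurable_EFinP.
  - by move=> w _; rewrite lee_fin.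
rewrite /f; under eq_integral do rewrite -sumEFin.
rewrite ge0_integral_sum//; last 2 first.
- by move=> l; apply/measurable_EFinP; apply: (@measurable_sum_exp_lin_comb 'I_L.+1).
- by move=> l w _; rewrite lee_fin sumr_ge0// => i _; exact: expR_ge0.
rewrite (eq_bigr (fun=> (L.+1%:R * expR (- (c * t) ^+ 2 / sig2))%:E)) => [|l _].
  by rewrite sumEFin sumr_const card_ord -[_ *+ G]mulr_natl.
rewrite integral_sum_exp_lin_comb; congr (_%:E).
rewrite (eq_bigr (fun=> expR (- (c * t) ^+ 2 / sig2))) => [|i _].
  by rewrite sumr_const card_ord -[_ *+ L.+1]mulr_natl.
congr expR.
under eq_bigr do rewrite cmodM cmodM cmodX (cmod_prim_root uP) expr1n mulr1 cmod_real// exprMn.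
by rewrite -mulr_sumr asig /lam; field; rewrite gt_eqF.
Qed.

(** Measurability, sign and finite mean are bundled so that a pointwise inequality between sums of
    exponentials becomes an inequality between real numbers, open to linear arithmetic. *)
Definition has_mean (f : T -> R) (v : R) :=
  [/\ measurable_fun setT f, forall w, 0 <= f w & (\int[P]_w (f w)%:E = v%:E)%E].

Lemma has_meanD f g v u : has_mean f v -> has_mean g u ->
  has_mean (fun w => f w + g w) (v + u).
Proof.
move=> [mf f0 fv] [mg g0 gu]; split; first exact: measurable_funD.
  by move=> w; rewrite addr_ge0.
under eq_integral do rewrite EFinD.
rewrite ge0_integralD//; try exact/measurable_EFinP.
- by rewrite fv gu.
- by move=> w _; rewrite lee_fin.
- by move=> w _; rewrite lee_fin.
Qed.

Lemma has_meanZ c f v : 0 <= c -> has_mean f v -> has_mean (fun w => c * f w) (c * v).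
Proof.
move=> c0 [mf f0 fv]; split; first exact: measurable_funM.
  by move=> w; rewrite mulr_ge0.
under eq_integral do rewrite EFinM.
rewrite ge0_integralZl_EFin ?fv//; try exact/measurable_EFinP.
by move=> w _; rewrite lee_fin.
Qed.

Lemma has_mean_cst c : 0 <= c -> has_mean (fun=> c) c.
Proof.
move=> c0; split => //.
by rewrite integral_cst//; rewrite [X in (_ * X)%E]probability_setT mule1.
Qed.

Lemma has_mean_sum (I : Type) (s : seq I) (Q : pred I) (f : I -> T -> R) (v : I -> R) :
  (forall i, Q i -> has_mean (f i) (v i)) ->
  has_mean (fun w => \sum_(i <- s | Q i) f i w) (\sum_(i <- s | Q i) v i).
Proof.
move=> fv; elim: s => [|i s IH].
  rewrite (_ : (fun w => _) = fun=> 0); last by apply/funext => w; rewrite big_nil.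
  by rewrite big_nil; exact: has_mean_cst.
rewrite (_ : (fun w => _) = fun w => (if Q i then f i w else 0) + \sum_(j <- s | Q j) f j w).
  rewrite big_cons; case: ifP => Qi; first exact: has_meanD (fv i Qi) IH.
  by under eq_fun do rewrite add0r.
by apply/funext => w; rewrite big_cons; case: ifP; rewrite ?add0r.
Qed.

Lemma has_mean_exp N a r :
  has_mean (fun w => expR (complex.Re (lin_comb N a w) + r))
           (expR ((\sum_(k < N) cmod (a k) ^+ 2) / 4 + r)).
Proof.
split; [exact: measurable_exp_lin_comb|by move=> w; exact: expR_ge0|].
exact: integral_exp_lin_comb.
Qed.

Lemma has_mean_indic E : measurable E -> has_mean (fun w => (w \in E)%:R) (fine (P E)).
Proof.
move=> mE; split => //; first exact: measurable_indic.
rewrite -[LHS]/(\int[P]_w (\1_E w)%:E)%E integral_indic// setIT fineK//.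
exact: fin_num_measure.
Qed.

Lemma has_mean_le f g v u : has_mean f v -> has_mean g u ->
  (forall w, f w <= g w) -> v <= u.
Proof.
move=> [mf f0 fv] [mg g0 gu] fg; rewrite -lee_fin -fv -gu.
by apply: ge0_le_integral => //; try exact/measurable_EFinP; move=> w _; rewrite lee_fin.
Qed.

Lemma lin_combD N a b w :
  lin_comb N a w + lin_comb N b w = lin_comb N (fun k => a k + b k) w.
Proof. by rewrite /lin_comb -big_split/=; apply: eq_bigr => k _; rewrite mulrDl. Qed.

Lemma lin_comb_ReZ N (c : R) a w :
  c * complex.Re (lin_comb N a w) = complex.Re (lin_comb N (fun k => c%:C * a k) w).
Proof. by rewrite lin_combZ complex_ReM/= mul0r subr0. Qed.

(* Under the law tilted by expR (lam * x), lam = 2 * s / sqrt v, a Gaussian x of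
   variance v / 2 concentrates around s * sqrt v; the truncation window is
   (1 - eps, 1 + eps) times this value. *)
Lemma max_Re_lin_comb_tail (m N : nat) (a : 'I_m -> nat -> R[i]) (v s eps : R) (E : set T) :
  (0 < m)%N -> 0 < v -> 0 <= s -> 0 <= eps <= 1 ->
  (forall j, \sum_(i < N) cmod (a j i) ^+ 2 = v) ->
  (forall j k, k != j -> \sum_(i < N) cmod (a j i + a k i) ^+ 2 = 2 * v) ->
  measurable E ->
  (forall w, E w -> forall j, complex.Re (lin_comb N (a j) w) <= (1 - eps) * (s * Num.sqrt v)) ->
  (P E <= (expR ((1 + 2 * eps) * s ^+ 2) / m%:R + 4 * expR (- (eps ^+ 2 * s ^+ 2)))%:E)%E.
Proof.
move=> m0 v0 s0 /andP[eps0 eps1] av aav mE EX.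
have q0 : 0 < Num.sqrt v by rewrite sqrtr_gt0.
have q2 : Num.sqrt v ^+ 2 = v by rewrite sqr_sqrtr// ltW.
set q := Num.sqrt v in q0 q2 EX.
pose lam := 2 * s / q.
have lam0 : 0 <= lam by rewrite /lam divr_ge0 ?(ltW q0)// mulr_ge0.
have lamv : lam ^+ 2 * v = 4 * s ^+ 2 by rewrite -q2 /lam; field; rewrite gt_eqF.
have lamq : lam * (s * q) = 2 * s ^+ 2 by rewrite /lam; field; rewrite gt_eqF.
have m1 : 0 < m%:R :> R by rewrite ltr0n.
(* The mean of the untruncated sum of exponentials, since lam^2 v / 4 = s^2. *)
pose mu := m%:R * expR (s ^+ 2).
have mu0 : 0 < mu by rewrite mulr_gt0// expR_gt0.
pose x w (j : 'I_m) := complex.Re (lin_comb N (a j) w).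
(* With [eps * lam] as the parameter of the correction factors, these merely rescale the tilt [lam]
   to [(1 - eps) * lam] and [(1 + eps) * lam]. *)
have key w := @truncated_second_moment R m (x w) lam (eps * lam) ((1 - eps) * (s * q))
  ((1 + eps) * (s * q)) mu (w \in E) lam0 (mulr_ge0 eps0 lam0) (ltW mu0) _.
have M0 c j r : has_mean (fun w => expR (c * x w j + r)) (expR (c ^+ 2 * v / 4 + r)).
  have := has_mean_exp N (fun k => c%:C * a j k) r.
  under eq_bigr do rewrite cmodM exprMn.
  rewrite -mulr_sumr av.
  have -> : cmod c%:C ^+ 2 = c ^+ 2 by rewrite cmod_sqr/= expr0n addr0.
  by under eq_fun do rewrite -lin_comb_ReZ.
have MU j : has_mean (fun w => expR (lam * x w j)) (expR (s ^+ 2)).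
  have := M0 lam j 0; rewrite lamv addr0 mulrAC divff ?mul1r//.
  by under eq_fun do rewrite addr0.
(* That v doubles for the sum of two combinations says that their real parts are uncorrelated; the
   mixed moment is therefore the square of the mean. *)
have MUU j k : k != j -> has_mean (fun w => expR (lam * x w j + lam * x w k)) (expR (s ^+ 2 * 2)).
  move=> kj; have := has_mean_exp N (fun i => lam%:C * (a j i + a k i)) 0.
  under eq_bigr do rewrite cmodM exprMn cmod_real//.
  rewrite -mulr_sumr aav// mulrCA lamv addr0.
  have -> : 2 * (4 * s ^+ 2) / 4 = s ^+ 2 * 2 by field.
  by under eq_fun do rewrite addr0 -lin_comb_ReZ -lin_combD raddfD/= mulrDr.
have Mb j : has_mean (fun w => expR (lam * x w j + lam * ((1 + eps) * (s * q)))) (expR (s ^+ 2 + 2 * (1 + eps) * s ^+ 2)).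
  have := M0 lam j (lam * ((1 + eps) * (s * q))).
  have -> : lam ^+ 2 * v / 4 + lam * ((1 + eps) * (s * q)) = s ^+ 2 + 2 * (1 + eps) * s ^+ 2.
    by rewrite mulrCA lamq lamv; field.
  done.
have Ml j : has_mean (fun w => expR (lam * x w j + eps * lam * ((1 - eps) * (s * q) - x w j))) (expR ((1 - eps ^+ 2) * s ^+ 2)).
  have := M0 ((1 - eps) * lam) j (eps * (1 - eps) * (lam * (s * q))).
  have -> : ((1 - eps) * lam) ^+ 2 * v / 4 + eps * (1 - eps) * (lam * (s * q)) = (1 - eps ^+ 2) * s ^+ 2.
    by rewrite exprMn -[_ * _ * v]mulrA lamv lamq; field.
  by move=> h; rewrite (_ : (fun w => _) = (fun w => expR ((1 - eps) * lam * x w j + eps * (1 - eps) * (lam * (s * q)))))//;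
    apply/funext => w; congr expR; ring.
have Mh j : has_mean (fun w => expR (lam * x w j + eps * lam * (x w j - (1 + eps) * (s * q)))) (expR ((1 - eps ^+ 2) * s ^+ 2)).
  have := M0 ((1 + eps) * lam) j (- (eps * (1 + eps) * (lam * (s * q)))).
  have -> : ((1 + eps) * lam) ^+ 2 * v / 4 - eps * (1 + eps) * (lam * (s * q)) = (1 - eps ^+ 2) * s ^+ 2.
    by rewrite exprMn -[_ * _ * v]mulrA lamv lamq; field.
  by move=> h; rewrite (_ : (fun w => _) = (fun w => expR ((1 + eps) * lam * x w j + - (eps * (1 + eps) * (lam * (s * q))))))//;
    apply/funext => w; congr expR; ring.
have ge2mu : 0 <= 2 * mu by rewrite mulr_ge0// ltW.
have lhs := has_meanD (has_meanZ (exprn_ge0 2 (ltW mu0)) (has_mean_indic mE))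
  (has_meanZ ge2mu (has_mean_sum (index_enum 'I_m) (fun j _ => MU j) (Q := xpredT))).
have rhs := has_meanD (has_meanD (has_meanD
   (has_mean_sum (index_enum 'I_m) (Q := xpredT) (fun j _ => has_mean_sum (index_enum 'I_m) (Q := fun k => k != j) (fun k kj => MUU j k kj)))
   (has_mean_sum (index_enum 'I_m) (Q := xpredT) (fun j _ => Mb j)))
   (has_meanZ ge2mu (has_meanD (has_mean_sum (index_enum 'I_m) (Q := xpredT) (fun j _ => Ml j))
      (has_mean_sum (index_enum 'I_m) (Q := xpredT) (fun j _ => Mh j)))))
   (has_mean_cst (exprn_ge0 2 (ltW mu0))).
have wE w : w \in E -> forall j, x w j <= (1 - eps) * (s * q) by rewrite inE => /EX.
have := has_mean_le lhs rhs (key wE).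
rewrite !sumr_const !card_ord.
(* Restoring the diagonal completes the double sum to exactly [mu ^+ 2]. *)
have S2 : \sum_(j < m) \sum_(k < m | k != j) expR (s ^+ 2 * 2) <= mu ^+ 2.
  have -> : mu ^+ 2 = \sum_(j < m) \sum_(k < m) expR (s ^+ 2 * 2).
    by rewrite !sumr_const !card_ord -mulrnA -[_ *+ (m * m)]mulr_natl natrM expRM_natr /mu; ring.
  by apply: ler_sum => j _; rewrite [leRHS](bigD1 j)//= lerDr expR_ge0.
rewrite -[P E]fineK ?fin_num_measure// lee_fin.
set p := fine (P E); set e := expR (s ^+ 2).
have -> : expR (s ^+ 2 + 2 * (1 + eps) * s ^+ 2) = e ^+ 3 * expR (2 * eps * s ^+ 2).
  by rewrite -expRM_natl -expRD; congr expR; ring.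
have -> : expR ((1 - eps ^+ 2) * s ^+ 2) = e * expR (- (eps ^+ 2 * s ^+ 2)).
  by rewrite -expRD; congr expR; ring.
have -> : expR ((1 + 2 * eps) * s ^+ 2) = e * expR (2 * eps * s ^+ 2).
  by rewrite -expRD; congr expR; ring.
set k := expR (2 * eps * s ^+ 2); set h := expR (- _).
rewrite -[e *+ m]mulr_natl -[(e ^+ 3 * k) *+ m]mulr_natl -[(e * h) *+ m]mulr_natl => hle.
have e0 : 0 < e by exact: expR_gt0.
(* The terms 2 mu^2 on the two sides cancel, and division by mu^2 = m^2 e^2 reduces the diagonal
   contribution m e^3 k to e k / m. *)
rewrite -(ler_pM2l (exprn_gt0 2 mu0)).
have -> : mu ^+ 2 * (e * k / m%:R + 4 * h) = m%:R * (e ^+ 3 * k) + 4 * mu ^+ 2 * h.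
  by rewrite /mu -/e; field; rewrite gt_eqF.
have e1 : mu * (m%:R * e) = mu ^+ 2 by rewrite expr2.
have e2 : mu * (m%:R * (e * h)) = mu ^+ 2 * h by rewrite /mu -/e; ring.
move: hle S2; rewrite -[2 * mu * (m%:R * e)]mulrA e1.
have -> : 2 * mu * (m%:R * (e * h) + m%:R * (e * h)) = 4 * (mu ^+ 2 * h) by rewrite -e2; ring.
rewrite [fine p%:E]/=; lra.
Qed.

End Concentration.

(** Exchanging the roles of points and exponents, the i-th summand is |h(u^i)|^2 for
    [h = 'X^j + 'X^k]; Parseval sees two coefficients equal to 1. *)
Lemma sum_sqr_norm_roots (R : realType) (m : nat) (u : R[i]) (j k : 'I_m) :
  m.-primitive_root u -> k != j ->
  \sum_(i < m) cmod ((u ^+ j) ^+ i + (u ^+ k) ^+ i) ^+ 2 = 2 * m%:R.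
Proof.
move=> uP kj; apply: complexI; rewrite rmorph_sum rmorphM/= !rmorph_nat.
pose h : {poly R[i]} := 'X^j + 'X^k.
have sh : (size h <= m)%N.
  by rewrite (leq_trans (size_polyD _ _))// geq_max !size_polyXn !ltn_ord.
have := parseval uP sh.
rewrite (eq_bigr (fun i : 'I_m => (cmod ((u ^+ j) ^+ i + (u ^+ k) ^+ i) ^+ 2)%:C)); last first.
  move=> i _; rewrite rmorphXn/= cmodC /h hornerD !hornerXn.
  by rewrite -!exprM ![(_ * i)%N]mulnC.
move=> ->; rewrite mulrC; congr (_ * _).
rewrite (bigD1 j)//= (bigD1 k)//= big1 => [|i /andP[ij ik]].
  rewrite /h !coefD !coefXn !eqxx -!val_eqE in kj *.
  by rewrite /= (negbTE kj) eq_sym (negbTE kj) addr0 add0r normr1 !expr1n addr0.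
by rewrite /h coefD !coefXn !val_eqE (negbTE ij) (negbTE ik) addr0 normr0 expr0n.
Qed.

(** * Tail bounds for the norms of the random polynomial and its derivative *)

Section RandomPoly.
Context (R : realType) (d : measure_display) (T : measurableType d).
Variables (P : probability T R) (A : nat -> {RV P >-> R[i]}).

Lemma size_random_poly n w : (size (random_poly A n w) <= n.+1)%N.
Proof. exact: size_poly. Qed.

Lemma random_poly_horner n w z :
  (random_poly A n w).[z] = lin_comb A n.+1 (fun k => z ^+ k) w.
Proof. by rewrite horner_poly; apply: eq_bigr => k _; rewrite mulrC. Qed.

(** The factor [z] has modulus one on the circle and keeps the exponent of each coefficient equal to
    its index. *)
Lemma random_poly_deriv_horner n w z :
  z * (random_poly A n w)^`().[z] = lin_comb A n.+1 (fun k => k%:R * z ^+ k) w.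
Proof.
rewrite (mulX_deriv_horner z (size_random_poly n w)); apply: eq_bigr => k _.
by rewrite coef_poly ltn_ord -[A k w *+ k]mulr_natl mulrAC.
Qed.

Lemma measurable_Re_coef_random_poly n k :
  measurable_fun setT (fun w => complex.Re (random_poly A n w)`_k).
Proof.
under eq_fun do rewrite coef_poly.
case: (k < n.+1)%N; last exact: measurable_cst.
exact: (measurableT_comp (@measurable_Re R) (measurable_funPT (A k))).
Qed.

Lemma measurable_Im_coef_random_poly n k :
  measurable_fun setT (fun w => complex.Im (random_poly A n w)`_k).
Proof.
under eq_fun do rewrite coef_poly.
case: (k < n.+1)%N; last exact: measurable_cst.
exact: (measurableT_comp (@measurable_Im R) (measurable_funPT (A k))).
Qed.

Lemma measurable_norm_random_poly n :
  measurable_fun setT (fun w => circle_sup_norm (random_poly A n w)).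
Proof.
apply: (measurable_circle_sup_norm (n := n)); first exact: size_random_poly.
  exact: measurable_Re_coef_random_poly.
exact: measurable_Im_coef_random_poly.
Qed.

Lemma measurable_norm_deriv_random_poly n :
  measurable_fun setT (fun w => circle_sup_norm (random_poly A n w)^`()).
Proof.
apply: (measurable_circle_sup_norm_deriv (n := n)); first exact: size_random_poly.
  exact: measurable_Re_coef_random_poly.
exact: measurable_Im_coef_random_poly.
Qed.

Lemma measurable_norm_random_poly_le n (b : R) :
  measurable [set w | circle_sup_norm (random_poly A n w) <= b].
Proof.
rewrite -[X in measurable X]setTI.
exact: (measurable_fun_le measurableT (measurable_norm_random_poly n) (measurable_cst _)).
Qed.

Lemma measurable_norm_deriv_random_poly_gt n (b c : R) :
  measurable [set w | b < c * circle_sup_norm (random_poly A n w)^`() ^+ 2].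
Proof.
rewrite -[X in measurable X]setTI.
apply: (measurable_fun_ltr (@measurable_cst _ _ _ _ setT _) _ measurableT (Y := [set true])) => //.
apply: measurable_funM => //; apply: measurable_funX.
exact: measurable_norm_deriv_random_poly.
Qed.

Lemma measurable_factor_random_poly n :
  measurable_fun setT (fun w => bernstein_markov_factor (random_poly A n w)).
Proof.
apply: (measurable_bernstein_markov_factor (n := n)); first exact: size_random_poly.
  exact: measurable_Re_coef_random_poly.
exact: measurable_Im_coef_random_poly.
Qed.

Hypothesis A_indep : mutually_independent A.
Hypothesis A_normal : forall (k : nat) (B : set R[i]), measurable B ->
  distribution P (A k) B = complex_normal_prob B.

(** The norm dominates the real parts of the values at the (n + 1)-th roots of unity, which are
    uncorrelated, with n + 1 as the energy of the coefficients of each. *)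
Lemma norm_random_poly_small n (s eps : R) : 0 <= s -> 0 <= eps <= 1 ->
  (P [set w | (circle_sup_norm (random_poly A n w) <= (1 - eps) * (s * Num.sqrt n.+1%:R))%R] <=
   (expR ((1 + 2 * eps) * s ^+ 2) / n.+1%:R + 4 * expR (- (eps ^+ 2 * s ^+ 2)))%:E)%E.
Proof.
move=> s0 heps; have [u uP] := prim_root_exists R[i] (ltn0Sn n).
have u1 : cmod u = 1 := cmod_prim_root uP.
apply: (max_Re_lin_comb_tail A_indep A_normal
  (a := fun (j : 'I_n.+1) k => (u ^+ j) ^+ k) (N := n.+1) (v := n.+1%:R)) => //.
- move=> j; under eq_bigr do rewrite !cmodX u1 !expr1n.
  by rewrite sumr_const card_ord.
- by move=> j k kj; exact: sum_sqr_norm_roots.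
- exact: measurable_norm_random_poly_le.
- move=> w hw j; apply: le_trans hw; rewrite -random_poly_horner.
  by apply: le_trans (Re_le_cmod _) (circle_sup_norm_ge _ _); rewrite cmodX u1 expr1n.
Qed.

Lemma norm_deriv_random_poly_large n m L (t : R) :
  (0 < n)%N -> (0 < m)%N -> (0 < L)%N -> 0 <= t ->
  (P [set w | ((n + m)%:R * t ^+ 2 < m%:R * circle_sup_norm (random_poly A n w)^`() ^+ 2)%R] <=
   ((n + m)%:R * (L.+1%:R * expR (- ((1 - 2 / L.+1%:R) * t) ^+ 2 / (\sum_(k < n.+1) k%:R ^+ 2)%R)))%:E)%E.
Proof.
move=> n0 m0 L0 t0.
have [u uP] : exists u : R[i], (n + m).-primitive_root u.
  by apply: prim_root_exists; rewrite addn_gt0 n0.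
have u1 : cmod u = 1 := cmod_prim_root uP.
apply: (max_lin_comb_tail A_indep A_normal
  (a := fun (l : 'I_(n + m)) k => k%:R * (u ^+ l) ^+ k) (N := n.+1) (sig2 := \sum_(k < n.+1) k%:R ^+ 2)) => //.
- rewrite (bigD1 (Ordinal (n0 : (1 < n.+1)%N)))//= expr1n ltr_pwDl// sumr_ge0//.
- by move=> l; apply: eq_bigr => k _; rewrite cmodM cmod_nat !cmodX u1 !expr1n mulr1.
- exact: measurable_norm_deriv_random_poly_gt.
(* Contraposition: if all n + m samples had modulus below t, sampling would contradict [hw]. *)
- move=> w /= hw; apply/existsP; apply: contraT; rewrite negb_exists => /forallP no.
  move: hw; rewrite ltNge => /negP; case.
  apply: (circle_sup_norm_sampling m0 uP); first exact: size_deriv_leq (leqW (size_random_poly n w)).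
  move=> l lN; have := no (Ordinal lN); rewrite -ltNge -random_poly_deriv_horner cmodM cmodX u1 expr1n mul1r.
  exact: ltW.
Qed.

End RandomPoly.

(** * Upper and lower limits, and bounded means *)

Section LimitBounds.
Variable R : realType.
Implicit Types (u : (\bar R)^nat) (l : \bar R).

Lemma limn_esup_le u l : (\forall n \near \oo, (u n <= l)%E) -> (limn_esup u <= l)%E.
Proof.
move=> ul; apply: (@le_trans _ _ (ereal_sup (u @` [set n | (u n <= l)%E]))).
  by apply: ereal_inf_lbound; exists [set n | (u n <= l)%E].
by apply: ge_ereal_sup => _ [n /= nl <-].
Qed.

Lemma limn_einf_ge u l : (\forall n \near \oo, (l <= u n)%E) -> (l <= limn_einf u)%E.
Proof.
move=> ul; rewrite /limn_einf leeNr; apply: limn_esup_le.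
by apply: filterS ul => n; rewrite leeN2.
Qed.

(** The left side is (n + 1)^(-c), in the form in which the tail bounds produce it; the threshold
    [expR (- ln e / c)] solves x^(-c) = e. *)
Lemma near_expRNln_le (c e : R) : 0 < c -> 0 < e ->
  \forall n \near \oo, expR (- (c * ln n.+1%:R)) <= e.
Proof.
move=> c0 e0; have := nbhs_infty_ger (expR (- ln e / c)).
apply: filterS => n hn; rewrite -[leRHS]lnK ?posrE// ler_expR lerNl mulrC -ler_pdivrMr//.
rewrite -ler_expR lnK ?posrE//; apply: le_trans hn _.
by rewrite ler_nat.
Qed.

End LimitBounds.

Lemma has_mean_bounded (R : realType) (d : measure_display) (T : measurableType d)
    (P : probability T R) (f : T -> R) (c : R) :
  measurable_fun setT f -> (forall w, 0 <= f w <= c) ->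
  has_mean P f (fine (\int[P]_w (f w)%:E)%E).
Proof.
move=> mf fc; have f0 w : 0 <= f w by case/andP: (fc w).
split => //; rewrite fineK// ge0_fin_numE; last by rewrite integral_ge0// => w _; rewrite lee_fin.
have c0 : 0 <= c by have /andP[] := fc point; exact: le_trans.
apply: (@le_lt_trans _ _ (\int[P]_w (cst c w)%:E)%E).
  apply: ge0_le_integral => //; try exact/measurable_EFinP.
  - by move=> w _; rewrite lee_fin.
  - by move=> w _; rewrite lee_fin; case/andP: (fc w).
by have [_ _ ->] := has_mean_cst P c0; exact: ltry.
Qed.

(* The slack: 10/9 (sampling at 10 n points) times 13/10 is less than
   2 * (19/20)^2 * 9/10, by a margin that absorbs lower-order terms for n >= 5. *)
Lemma bernstein_markov_factor_good (R : realType) (n : nat) (p : {poly R[i]}) (s t : R) :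
  (5 <= n)%N -> 0 < s ->
  s ^+ 2 = 9 / 10 * ln n.+1%:R ->
  t ^+ 2 = 13 / 10 * (\sum_(k < n.+1) k%:R ^+ 2) * ln n.+1%:R ->
  (1 - 1 / 20) * (s * Num.sqrt n.+1%:R) < circle_sup_norm p ->
  (9 * n)%:R * circle_sup_norm p^`() ^+ 2 <= (n + 9 * n)%:R * t ^+ 2 ->
  bernstein_markov_factor p <= Num.sqrt (2 / 3) * n%:R.
Proof.
move=> n5 s0 s2 t2 hM hD.
set M := circle_sup_norm p in hM *; set D := circle_sup_norm p^`() in hD *.
have M0 : 0 < M.
  by apply: le_lt_trans hM; rewrite !mulr_ge0 ?sqrtr_ge0 ?(ltW s0)//; lra.
have D0 : 0 <= D := circle_sup_norm_ge0 _.
have n0 : 0 < n%:R :> R by rewrite ltr0n (leq_trans _ n5).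
rewrite /bernstein_markov_factor -/M -/D ler_pdivrMr//.
rewrite -(@ler_pXn2r _ 2)// ?nnegrE ?mulr_ge0 ?sqrtr_ge0 ?(ltW n0) ?(ltW M0)//.
rewrite !exprMn sqr_sqrtr; last by rewrite divr_ge0.
have hM2 : (19 / 20) ^+ 2 * (s ^+ 2 * n.+1%:R) <= M ^+ 2.
  have -> : (19 / 20) ^+ 2 * (s ^+ 2 * n.+1%:R) = ((1 - 1 / 20) * (s * Num.sqrt n.+1%:R)) ^+ 2.
    by rewrite !exprMn sqr_sqrtr//; field.
  by rewrite lerXn2r ?nnegrE ?(ltW hM) ?(ltW M0)// !mulr_ge0 ?sqrtr_ge0 ?(ltW s0)//; lra.
have S6 j : \sum_(k < j.+1) k%:R ^+ 2 = j%:R * (j%:R + 1) * (2 * j%:R + 1) / 6 :> R.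
  elim: j => [|j IH]; first by rewrite big_ord_recl big_ord0 expr0n addr0 !mul0r.
  by rewrite big_ord_recr/= IH -natr1; field.
have l0 : 0 < ln n.+1%:R :> R by rewrite -(pmulr_rgt0 _ (_ : 0 < 9 / 10 :> R)) -?s2 ?exprn_gt0.
move: hD hM2; rewrite t2 s2 S6 natrD natrM; set l := ln _ in l0 *.
rewrite -[n.+1%:R]natr1 => hD hM2; set N := n%:R in n0 hD hM2 *.
have N5 : 5 <= N by rewrite ler_nat.
have hD' : D ^+ 2 <= 10 / 9 * (13 / 10 * (N * (N + 1) * (2 * N + 1) / 6) * l).
  by rewrite -(ler_pM2l (_ : 0 < 9 * N)) ?mulr_gt0//; lra.
apply: le_trans hD' _.
have hM3 := ler_wpM2l (_ : 0 <= 2 / 3 * N ^+ 2) hM2.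
apply: le_trans (hM3 _); last by rewrite mulr_ge0// exprn_ge0// ltW.
(* The difference is a positive multiple of about 0.0600 N - 0.2407, which is nonnegative from N = 5
   on. *)
rewrite -subr_ge0.
have -> : 2 / 3 * N ^+ 2 * ((19 / 20) ^+ 2 * (9 / 10 * l * (N + 1))) -
   10 / 9 * (13 / 10 * (N * (N + 1) * (2 * N + 1) / 6) * l) =
   N * (N + 1) * l * (2 / 3 * (19 / 20) ^+ 2 * (9 / 10) * N - 13 / 54 * (2 * N + 1)) by field.
by rewrite !mulr_ge0 ?(ltW l0) ?(ltW n0)//; lra.
Qed.

(** * The two bounds *)

Section Reversal.
Context (R : realType) (d : measure_display) (T : measurableType d).
Variables (P : probability T R) (A : nat -> {RV P >-> R[i]}).
Hypothesis A_indep : mutually_independent A.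
Hypothesis A_normal : forall (k : nat) (B : set R[i]), measurable B ->
  distribution P (A k) B = complex_normal_prob B.

(** Independence turns each side into a product of standard normal probabilities, and k -> n - k
    permutes the factors. *)
Lemma reversed_law n (B : 'I_n.+1 -> set R[i]) : (forall i, measurable (B i)) ->
  P (\bigcap_(i : 'I_n.+1) (A i @^-1` B i)) = P (\bigcap_(i : 'I_n.+1) (A (n - i)%N @^-1` B i)).
Proof.
move=> mB.
have law k C : measurable C -> P (A k @^-1` C) = complex_normal_prob C := A_normal k (B := C).
transitivity (\prod_(k < n.+1) complex_normal_prob (B k))%E.
  have -> : \bigcap_(i : 'I_n.+1) (A i @^-1` B i) = \bigcap_(k in `I_n.+1) (A k @^-1` B (inord k)).
    apply/seteqP; split => w /= wB k.
      by move=> kn; have := wB (inord k) Logic.I; rewrite /= inordK.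
    by move=> _; have := wB k (ltn_ord k); rewrite /= inord_val.
  rewrite (mutually_independent_prefix A_indep n.+1 (fun k => mB (inord k))).
  by apply: eq_bigr => k _; rewrite inord_val law.
have -> : \bigcap_(i : 'I_n.+1) (A (n - i)%N @^-1` B i) = \bigcap_(k in `I_n.+1) (A k @^-1` B (inord (n - k))).
  apply/seteqP; split => w /= wB k.
    move=> kn; have := wB (inord (n - k)) Logic.I.
    by rewrite /= inordK ?ltnS ?leq_subr// subKn.
  by move=> _; have := wB (n - k)%N (leq_subr k n); rewrite /= subKn ?inord_val// leq_ord.
rewrite (mutually_independent_prefix A_indep n.+1 (fun k => mB (inord (n - k)))).
rewrite (reindex_inj rev_ord_inj)/=; apply: eq_bigr => k _.
rewrite law//; congr (complex_normal_prob (B _)).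
by apply/val_inj; rewrite /= subSS inordK// ltnS leq_subr.
Qed.

(** The ratio is a nonnegative measurable function of the tuple of coefficients, whose law is
    unchanged by reversal. *)
Lemma integral_factor_rev n :
  (\int[P]_w (bernstein_markov_factor (random_poly A n w))%:E =
   \int[P]_w (bernstein_markov_factor (rev_poly n (random_poly A n w)))%:E)%E.
Proof.
pose f (t : n.+1.-tuple R[i]) : {poly R[i]} := \poly_(k < n.+1) tnth t (inord k).
pose F t : \bar R := (bernstein_markov_factor (f t))%:E.
have mcoef k : measurable_fun setT (fun t => (f t)`_k).
  under eq_fun do rewrite coef_poly.
  case: (k < n.+1)%N; last exact: measurable_cst.
  exact: measurable_tnth.
have mF : measurable_fun setT F.
  apply/measurable_EFinP; apply: (measurable_bernstein_markov_factor (n := n)).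
  - by move=> t; exact: size_poly.
  - by move=> k; apply: (measurableT_comp (@measurable_Re R) (mcoef k)).
  - by move=> k; apply: (measurableT_comp (@measurable_Im R) (mcoef k)).
have F0 t : (0 <= F t)%E by rewrite lee_fin bernstein_markov_factor_ge0.
have := tuple_law_unique (X := fun (i : 'I_n.+1) w => A i w) (Y := fun i w => A (n - i)%N w)
  (fun i => measurable_funPT (A i)) (fun i => measurable_funPT (A (n - i)%N)) (@reversed_law n) mF F0.
have -> : (fun w => F [tuple A i w | i < n.+1]) = fun w => (bernstein_markov_factor (random_poly A n w))%:E.
  apply/funext => w; congr (bernstein_markov_factor _)%:E; apply/polyP => k.
  by rewrite !coef_poly; case: ifP => // kn; rewrite tnth_mktuple inordK.
move=> ->; apply: eq_integral => w _; congr (bernstein_markov_factor _)%:E; apply/polyP => k.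
by rewrite !coef_poly; case: ifP => // kn; rewrite tnth_mktuple inordK// ltnS leq_subr.
Qed.

End Reversal.

Section FactorMean.
Context (R : realType) (d : measure_display) (T : measurableType d).
Variables (P : probability T R) (A : nat -> {RV P >-> R[i]}).
Hypothesis A_indep : mutually_independent A.
Hypothesis A_normal : forall (k : nat) (B : set R[i]), measurable B ->
  distribution P (A k) B = complex_normal_prob B.

(** Here [k] is (n + 1)^(-1/500), which decays more slowly than every error term met below. The
    lower bound averages the ratios of the polynomial and of its reversal; the upper bound splits
    off two rare events. *)
Lemma factor_mean_bounds n : (5 <= n)%N ->
  let k : R := expR (- (1 / 500 * ln n.+1%:R)) in
  exists v, [/\ has_mean P (fun w => bernstein_markov_factor (random_poly A n w)) v,
    n%:R * (1 - 5 * k) <= 2 * v & v <= Num.sqrt (2 / 3) * n%:R + n%:R * (820 * k)].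
Proof.
move=> n5 k; pose l : R := ln n.+1%:R.
have kE : k = expR (- (1 / 500 * l)) by [].
have n0 : (0 < n)%N by exact: leq_trans n5.
have N0 : 0 < n%:R :> R by rewrite ltr0n.
have l0 : 0 < l by rewrite ln_gt0// ltr1n ltnS.
have el : n.+1%:R = expR l by rewrite lnK// posrE.
pose S : R := \sum_(k < n.+1) k%:R ^+ 2.
have S0 : 0 < S.
  by rewrite /S (bigD1 (Ordinal (n0 : (1 < n.+1)%N)))//= expr1n ltr_pwDl// sumr_ge0.
pose s := Num.sqrt (9 / 10 * l); pose t := Num.sqrt (13 / 10 * S * l).
have s2 : s ^+ 2 = 9 / 10 * l by rewrite sqr_sqrtr// mulr_ge0// ltW.
have t2 : t ^+ 2 = 13 / 10 * S * l by rewrite sqr_sqrtr// !mulr_ge0// ltW.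
have s0 : 0 < s by rewrite sqrtr_gt0 mulr_gt0.
have t0 : 0 <= t by exact: sqrtr_ge0.
pose M w := circle_sup_norm (random_poly A n w).
pose D w := circle_sup_norm (random_poly A n w)^`().
pose E1 : set T := [set w | M w <= (1 - 1 / 20) * (s * Num.sqrt n.+1%:R)].
pose E2 : set T := [set w | (n + 9 * n)%:R * t ^+ 2 < (9 * n)%:R * D w ^+ 2].
have mE1 : measurable E1 by exact: measurable_norm_random_poly_le.
have mE2 : measurable E2 by exact: measurable_norm_deriv_random_poly_gt.
(* With eps = 1/20 the two error terms are (n + 1)^(11/10 * 9/10 - 1) = (n + 1)^(-1/100) and 4 (n +
   1)^(-9/4000); the exponent 1/500 lies just below 9/4000. *)
have p1 : fine (P E1) <= 5 * k.
  rewrite -lee_fin fineK ?fin_num_measure//.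
  apply: le_trans (norm_random_poly_small A_indep A_normal n (ltW s0) (_ : 0 <= 1 / 20 <= 1)) _; first lra.
  rewrite lee_fin s2 el -expRN -expRD (_ : 5 * k = k + 4 * k); last by ring.
  by rewrite kE; apply: lerD; rewrite ?ler_pM2l// ler_expR; lra.
(* The 10 n sampling points and, for L = 19, twenty directions give the factor 200 n; since (9/10)^2
   * 13/10 = 1.053, a power (n + 1)^(-0.053) is left over. *)
have p2 : fine (P E2) <= 200 * k.
  rewrite -lee_fin fineK ?fin_num_measure//.
  apply: le_trans (norm_deriv_random_poly_large A_indep A_normal (L := 19) n0 _ _ t0) _ => //.
    by rewrite muln_gt0.
  rewrite lee_fin -/S exprMn t2.
  have -> : - ((1 - 2 / 20) ^+ 2 * (13 / 10 * S * l)) / S = - l - 53 / 1000 * l.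
    by field; rewrite gt_eqF.
  rewrite expRD expRN -el natrD natrM; set h := expR _.
  have hk : h <= k by rewrite kE ler_expR; lra.
  have nm : n%:R <= n.+1%:R :> R by rewrite ler_nat.
  have h0 : 0 <= 200 * (n.+1%:R^-1 * h) by rewrite !mulr_ge0 ?invr_ge0 ?expR_ge0.
  have := ler_wpM2r h0 nm; rewrite [leRHS]mulrCA mulVKf ?pnatr_eq0//.
  by move: (_^-1 * h) => x; lra.
pose r w := bernstein_markov_factor (random_poly A n w).
pose r' w := bernstein_markov_factor (rev_poly n (random_poly A n w)).
have r4 w : 0 <= r w <= 4 * n%:R.
  by rewrite bernstein_markov_factor_ge0 (bernstein_markov_factor_le n0 (size_random_poly A n w)).
have rv := has_mean_bounded P (measurable_factor_random_poly A n) r4.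
set v := fine _ in rv.
have rv' : has_mean P r' v.
  split.
  - apply: (measurable_bernstein_markov_factor (n := n)) => [w|j|j]; first exact: size_poly.
      under eq_fun do rewrite coef_poly.
      case: (j < n.+1)%N; last exact: measurable_cst.
      exact: measurable_Re_coef_random_poly.
    under eq_fun do rewrite coef_poly.
    case: (j < n.+1)%N; last exact: measurable_cst.
    exact: measurable_Im_coef_random_poly.
  - by move=> w; exact: bernstein_markov_factor_ge0.
  - by case: rv => _ _ <-; rewrite integral_factor_rev.
exists v; split => //.
  have := has_mean_le (has_mean_cst P (ltW N0))
    (has_meanD (has_meanZ (ltW N0) (has_mean_indic P mE1)) (has_meanD rv rv')) _.
  (* Outside [E1] the norm is positive, which the reversal inequality requires since the zero
     polynomial has ratio 0; on [E1] the indicator term alone supplies n. *)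
  have h w : n%:R <= n%:R * (w \in E1)%:R + (r w + r' w).
    have [wE|wE] := boolP (w \in E1).
      by rewrite mulr1 lerDl addr_ge0 ?bernstein_markov_factor_ge0.
    rewrite mulr0 add0r; apply: bernstein_markov_factor_rev; first exact: size_poly.
    move: wE; rewrite notin_setE /E1/= => /negP; rewrite -ltNge; apply: le_lt_trans.
    by rewrite !mulr_ge0 ?sqrtr_ge0//; lra.
  move=> /(_ h) {}h.
  have := ler_wpM2l (ltW N0) p1; lra.
have := has_mean_le rv (has_meanD (has_mean_cst P (_ : 0 <= Num.sqrt (2 / 3) * n%:R :> R))
  (has_meanZ (_ : 0 <= 4 * n%:R :> R) (has_meanD (has_mean_indic P mE1) (has_mean_indic P mE2)))) _.
have c0 : 0 <= Num.sqrt (2 / 3) * n%:R :> R by rewrite mulr_ge0 ?sqrtr_ge0.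
have c4 : 0 <= 4 * n%:R :> R by rewrite mulr_ge0.
(* On an exceptional event the crude bound 4 n applies, whence 820 = 4 * (5 + 200). *)
have h w : r w <= Num.sqrt (2 / 3) * n%:R + 4 * n%:R * ((w \in E1)%:R + (w \in E2)%:R).
  have /andP[_ rw] := r4 w.
  have [wE1|wE1] := boolP (w \in E1).
    by apply: le_trans rw _; rewrite ler_wpDl// ler_peMr// lerDl.
  have [wE2|wE2] := boolP (w \in E2).
    by apply: le_trans rw _; rewrite ler_wpDl// add0r mulr1.
  rewrite addr0 mulr0 addr0; apply: (bernstein_markov_factor_good n5 s0 s2 t2).
    by move: wE1; rewrite notin_setE /E1/= => /negP; rewrite -ltNge.
  by move: wE2; rewrite notin_setE /E2/= => /negP; rewrite -leNgt.
move=> /(_ c0 c4 h) {}h.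
apply: le_trans h _; rewrite lerD2l [4 * n%:R]mulrC -mulrA ler_wpM2l ?(ltW N0)//; lra.
Qed.

End FactorMean.

Theorem theorem7 (R : realType) (d : measure_display) (T : measurableType d)
    (P : probability T R) (A : nat -> {RV P >-> R[i]})
    (A_indep : mutually_independent A)
    (A_normal : forall (k : nat) (B : set R[i]), measurable B ->
       distribution P (A k) B = complex_normal_prob B) :
  let E_n (n : nat) : \bar R :=
    ((n%:R^-1)%:E *
     'E_P[fun w : T => bernstein_markov_factor (random_poly A n w)])%E in
  [/\ ((2^-1 : R)%:E <= limn_einf E_n)%E,
      (limn_einf E_n <= limn_esup E_n)%E
    & (limn_esup E_n <= (Num.sqrt (2 / 3) : R)%:E)%E].
Proof.
move=> E_n.
have Ev n v : has_mean P (fun w => bernstein_markov_factor (random_poly A n w)) v ->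
    E_n n = (n%:R^-1 * v)%:E.
  by move=> [_ _ nv]; rewrite /E_n unlock nv -EFinM.
split; last 1 first.
(* A loss of [e] is allowed, and 820 (n + 1)^(-1/500) falls below it for large n. *)
- apply/lee_addgt0Pr => e e0; apply: limn_esup_le.
  near=> n.
  have n5 : (5 <= n)%N by near: n; exact: nbhs_infty_ge.
  have N0 : 0 < n%:R :> R by rewrite ltr0n (leq_trans _ n5).
  have [v [/Ev -> _ vle]] := factor_mean_bounds A_indep A_normal n5.
  rewrite -EFinD lee_fin ler_pdivrMl// mulrDr; apply: le_trans vle _.
  rewrite [n%:R * Num.sqrt _]mulrC lerD2l; apply: ler_wpM2l; first exact: ltW.
  have : expR (- (1 / 500 * ln n.+1%:R)) <= e / 820.
    by near: n; apply: near_expRNln_le; lra.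
  by move: (expR _) => x; lra.
- apply/lee_subgt0Pr => e e0; apply: limn_einf_ge.
  near=> n.
  have n5 : (5 <= n)%N by near: n; exact: nbhs_infty_ge.
  have N0 : 0 < n%:R :> R by rewrite ltr0n (leq_trans _ n5).
  have [v [/Ev -> vge _]] := factor_mean_bounds A_indep A_normal n5.
  rewrite -EFinB lee_fin ler_pdivlMl// -(ler_pM2l (_ : 0 < 2 :> R))//.
  apply: le_trans vge; rewrite mulrCA ler_wpM2l ?(ltW N0)//.
  (* After doubling, five times this power may be as large as 2 e, so [e / 5] leaves room. *)
  have : expR (- (1 / 500 * ln n.+1%:R)) <= e / 5.
    by near: n; apply: near_expRNln_le; lra.
  by move: (expR _) => x; lra.
- exact: limn_einf_sup.
Unshelve. all: by end_near. Qed.
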